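(* Let $\mathbb{D}=\{z\in\mathbb{C}: |z|<1\}$, let $\varphi:\mathbb{D}\to\mathbb{R}$ be a radial function (that is, $\varphi(z_1)=\varphi(|z_1|)$ for all $z_1\in\mathbb{D}$), and let $$\Omega=\{(z_1,z_2)\in\mathbb{C}^2 \;:\; z_1\in\mathbb{D}\ \text{ and }\ |z_2|<e^{-\varphi(z_1)}\}.$$ Assume that $\Omega$ is a complete pseudoconvex Reinhardt domain and that the monomials $\{z^{\alpha}\}_{\alpha\in\mathbb{N}^2}$ (or a subset of them) form a complete orthogonal system in the Bergman space $A^2(\Omega)$. Let $f\in A^2(\Omega)$. If the Hankel operator $H_{\overline{f}}$ is Hilbert--Schmidt on $A^2(\Omega)$, then $f$ is constant.
   Context: Here $\mathbb{N}=\{0,1,2,\dots\}$ and $z^\alpha=z_1^{\alpha_1}z_2^{\alpha_2}$. $L^2(\Omega)$ is the space of square-integrable functions on $\Omega$ with respect to Lebesgue measure $dV$, and $A^2(\Omega)$ (the Bergman space) is its closed subspace of square-integrable holomorphic functions. $P:L^2(\Omega)\to A^2(\Omega)$ is the orthogonal (Bergman) projection. A domain $\Omega\subset\mathbb{C}^2$ is complete Reinhardt if $(z_1,z_2)\in\Omega$ and $|w_j|\le|z_j|$ for $j=1,2$ imply $(w_1,w_2)\in\Omega$. For $f\in A^2(\Omega)$, the Hankel operator with anti-holomorphic symbol $\overline{f}$ is the (possibly unbounded) densely defined operator on $A^2(\Omega)$, with values in $L^2(\Omega)$, given by $H_{\overline f}(g)=(I-P)(\overline{f}g)$ for those $g\in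 A^2(\Omega)$ with $\overline{f}g\in L^2(\Omega)$. A bounded linear operator $T$ on a Hilbert space $H$ is Hilbert--Schmidt if there is an orthonormal basis $\{\xi_j\}$ of $H$ with $\sum_j\|T(\xi_j)\|^2<\infty$ (the sum does not depend on the choice of orthonormal basis). ''$H_{\overline f}$ is Hilbert--Schmidt on $A^2(\Omega)$'' means that the densely defined operator $H_{\overline f}$ extends to a bounded operator $A^2(\Omega)\to L^2(\Omega)$ that is Hilbert--Schmidt. *)

(* Defs.v *)
From HB Require Import structures.
From mathcomp Require Import all_boot all_order all_algebra.
From mathcomp Require Import complex.
From mathcomp Require Import all_classical all_reals all_analysis.
From mathcomp Require Import measurable_realfun.

Set Implicit Arguments.
Unset Strict Implicit.
Unset Printing Implicit Defensive.

Import Order.TTheory GRing.Theory Num.Theory.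
Import numFieldNormedType.Exports.

Local Open Scope classical_set_scope.
Local Open Scope ring_scope.
Local Open Scope complex_scope.

(* C with its usual topology, as a normed module over itself: on C^2 the
   library's [differentiable] is then complex differentiability. *)
HB.instance Definition _ (R : realType) :=
  NormedModule.copy (complex R) (GRing.regular (complex R)).

Section lebesgue.
Variable R : realType.
Let mu := @lebesgue_measure R.

Definition lebesgue2 :
    set (measurableTypeR R * measurableTypeR R)%type -> \bar R :=
  (mu \x mu)%E.

HB.instance Definition _ := Measure.on lebesgue2.

Lemma sigma_finite_lebesgue2 : sigma_finite setT lebesgue2.
Proof.
have /sigma_finiteP[F [TF ndF Foo]] := sigma_finiteT mu.
exists (fun n => F n `*` F n).
  rewrite -setXTT TF predeqE => -[x y]; split.
    move=> [/= [n _ Fnx] [k _ Gky]]; exists (maxn n k) => //; split.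
    - by move: x Fnx; exact/subsetPset/ndF/leq_maxl.
    - by move: y Gky; exact/subsetPset/ndF/leq_maxr.
  by move=> [n _ []/= ? ?]; split; exists n.
move=> k; have [? ?] := Foo k.
split; first exact: measurableX.
by rewrite /lebesgue2 product_measure1E// lte_mul_pinfty// ge0_fin_numE.
Qed.

HB.instance Definition _ :=
  Measure_isSigmaFinite.Build _ _ _ lebesgue2 sigma_finite_lebesgue2.

(* Lebesgue measure dV of C^2 = R^4, on the Borel (product) sigma-algebra;
   [toC2] is the identification (x1, y1), (x2, y2) |-> (x1 + i y1, x2 + i y2). *)
Definition lebesgue4 := (lebesgue2 \x lebesgue2)%E.

HB.instance Definition _ := Measure.on lebesgue4.

Definition toC2 (x : measurableTypeR R * measurableTypeR R *
    (measurableTypeR R * measurableTypeR R)) : R[i] * R[i] :=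
  (x.1.1 +i* x.1.2, x.2.1 +i* x.2.2).

End lebesgue.
Arguments lebesgue4 {R}.
Arguments toC2 {R} x.

Section domains.
Context {R : realType}.
Local Notation C := R[i].
Local Notation C2 := (R[i] * R[i])%type.

Definition domain (Omega : set C2) : Prop :=
  [/\ open Omega, Omega !=set0 & connected Omega].

Definition complete_reinhardt (Omega : set C2) : Prop :=
  forall z w : C2, Omega z -> `|w.1| <= `|z.1| -> `|w.2| <= `|z.2| -> Omega w.

(* Continuous plurisubharmonic functions: the restriction to every complex line
   satisfies the sub-mean value inequality on all closed discs inside Omega.
   The function is real-valued and continuous, hence integrable on circles. *)
Definition continuous_psh (Omega : set C2) (u : C2 -> R) : Prop :=
  {within Omega, continuous u} /\
  forall a b : C2, (forall w : C, `|w| <= 1 -> Omega (a + w *: b)) ->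
    u a <= (2 * pi)^-1 *
      \int[lebesgue_measure]_(t in `[0, 2 * pi]) u (a + (cos t +i* sin t) *: b).

(* Omega has a continuous plurisubharmonic exhaustion function: every sublevel
   set is relatively compact in Omega. *)
Definition pseudoconvex (Omega : set C2) : Prop :=
  exists u : C2 -> R, continuous_psh Omega u /\
    forall c : R, let K := closure [set z | Omega z /\ u z < c] in
      compact K /\ K `<=` Omega.

Definition hartogs (phi : C -> R) : set C2 :=
  [set z | `|z.1| < 1 /\ `|z.2| < (expR (- phi z.1))%:C].

Definition monomial (alpha : nat * nat) (z : C2) : C :=
  z.1 ^+ alpha.1 * z.2 ^+ alpha.2.

End domains.

(* Elements of L^2(Omega) are represented by functions on C^2, of which only the
   values on Omega matter, and equality in L^2(Omega) is [ae_eq_on]. *)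
Section L2.
Context {R : realType}.
Local Notation C := R[i].
Local Notation C2 := (R[i] * R[i])%type.
Variable Omega : set C2.

Definition ae_eq_on (f g : C2 -> C) : Prop :=
  {ae lebesgue4, forall x, Omega (toC2 x) -> f (toC2 x) = g (toC2 x)}.

Definition L2normsq (f : C2 -> C) : \bar R :=
  (\int[lebesgue4]_(x in toC2 @^-1` Omega)
    (Normc.normc (f (toC2 x)) ^+ 2)%:E)%E.

Definition L2 (f : C2 -> C) : Prop :=
  [/\ measurable_fun (toC2 @^-1` Omega) (fun x => complex.Re (f (toC2 x))),
      measurable_fun (toC2 @^-1` Omega) (fun x => complex.Im (f (toC2 x)))
    & (L2normsq f < +oo)%E].

Definition L2inner (f g : C2 -> C) : C :=
  (\int[lebesgue4]_(x in toC2 @^-1` Omega)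
     complex.Re (f (toC2 x) * (g (toC2 x))^*%C)) +i*
  (\int[lebesgue4]_(x in toC2 @^-1` Omega)
     complex.Im (f (toC2 x) * (g (toC2 x))^*%C)).

Definition holomorphic (f : C2 -> C) : Prop :=
  forall z, Omega z -> differentiable f z.

(* A^2(Omega) *)
Definition bergman (f : C2 -> C) : Prop := holomorphic f /\ L2 f.

(* The graph of the Bergman projection: p = P h, for h in L^2(Omega). *)
Definition bergman_projection (h p : C2 -> C) : Prop :=
  [/\ L2 h, bergman p
    & forall k, bergman k -> L2inner (fun z => h z - p z) k = 0].

(* The graph of the Hankel operator with symbol conj(f), on its natural domain:
   g in A^2(Omega), conj(f) g in L^2(Omega) and h = (I - P)(conj(f) g). *)
Definition hankel (f g h : C2 -> C) : Prop :=
  bergman g /\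
  exists2 p, bergman_projection (fun z => (f z)^*%C * g z) p
    & ae_eq_on h (fun z => (f z)^*%C * g z - p z).

(* (e_i)_{i in S}: nonzero pairwise orthogonal elements of A^2(Omega) whose
   finite linear combinations are dense in A^2(Omega). *)
Definition complete_orthogonal_system (I : choiceType) (S : set I)
    (e : I -> C2 -> C) : Prop :=
  [/\ forall i, S i -> bergman (e i) /\ L2normsq (e i) <> 0%E,
      forall i j, S i -> S j -> i <> j -> L2inner (e i) (e j) = 0
    & forall g, bergman g -> forall eps : R, 0 < eps ->
        exists (s : seq I) (c : I -> C), (forall i, i \in s -> S i) /\
          (L2normsq (fun z => g z - \sum_(i <- s) c i * e i z)%R < eps%:E)%E].

Definition orthonormal_basis (I : choiceType) (e : I -> C2 -> C) : Prop :=
  complete_orthogonal_system setT e /\ forall i, L2normsq (e i) = 1%E.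

(* Bounded linear operators A^2(Omega) -> L^2(Omega). *)
Definition bounded_operator (T : (C2 -> C) -> (C2 -> C)) : Prop :=
  [/\ forall g, bergman g -> L2 (T g),
      forall (a : C) g h, bergman g -> bergman h ->
        ae_eq_on (T (fun z => a * g z + h z)) (fun z => a * T g z + T h z)
    & exists M : R, forall g, bergman g ->
        (L2normsq (T g) <= (M ^+ 2)%:E * L2normsq g)%E].

Definition hilbert_schmidt (T : (C2 -> C) -> (C2 -> C)) : Prop :=
  bounded_operator T /\
  exists (I : choiceType) (xi : I -> C2 -> C),
    orthonormal_basis xi /\
    (\esum_(i in [set: I]) L2normsq (T (xi i)) < +oo)%E.

Definition hankel_hilbert_schmidt (f : C2 -> C) : Prop :=
  exists T, hilbert_schmidt T /\
    forall g, bergman g -> L2 (fun z => (f z)^*%C * g z) -> hankel f g (T g).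

End L2.

(* Main.v *)
Require Import Defs.
From mathcomp Require Import all_boot all_order all_algebra.
From mathcomp Require Import complex.
From mathcomp Require Import all_classical all_reals all_analysis.
From mathcomp Require Import measurable_realfun.
From mathcomp Require Import ring lra.

(** Notation: N g is the squared norm of the monomial z^g, and f_a is the
coefficient of f on z^a, i.e. <f, z^a> / N a.

Fix a multi-index a <> 0. For every g let w_g be the function
conj(z^a) z^g - (N g / N (g - a)) z^(g - a), without the last term unless
g >= a; it is the image of z^g under the Hankel operator of symbol conj(z^a).
The w_g are orthogonal to the Bergman space and to each other, and for every f
in the Bergman space <conj(f) z^g, w_g> = conj(f_a) |w_g|^2
([inner_conj_hankel_monomial]). A bounded Hilbert-Schmidt operator T satisfies
sum_g |<T e_g, w_g>|^2 / (|w_g|^2 |e_g|^2) <= |T|_HS^2 for any orthogonal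
family w ([hilbert_schmidt_bound]), so a Hilbert-Schmidt Hankel operator with
symbol conj(f) forces |f_a|^2 sum_g |w_g|^2 / N g < oo.

That sum diverges. With u_g = N (g + a) / N g its general term is
u_g - u_(g - a), or just u_g if g >= a fails, so on a half-line b, b + a,
b + 2a, ... starting where b >= a fails it telescopes to the last ratio u.
These ratios cannot remain below some d > 0 independent of the line, because
N g >= v s^|g| with v, s > 0: the domain contains a cube on which both
coordinates are bounded away from 0 ([sqnorm_monomial_ge]). In dimension two
there are infinitely many such half-lines, whence f_a = 0
([taylor_coeff_eq0]).

Consequently f - f_0 is orthogonal to all monomials, hence has norm 0 since
they span a dense subspace, and a continuous function of norm 0 vanishes on the
open set ([bergman_eq0]).

The orthogonality of all the monomials, and not only of those in the given
complete system, comes from the invariance of Lebesgue measure and of the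
domain under rotation of each coordinate; a plane rotation is a product of
three shears, and shears preserve area by Fubini and translation invariance
([preserving_rotation], [monomial_orthogonal]). *)

Set Implicit Arguments.
Unset Strict Implicit.
Unset Printing Implicit Defensive.

Import Order.TTheory GRing.Theory Num.Theory.
Import numFieldNormedType.Exports.
Local Open Scope classical_set_scope.
Local Open Scope ring_scope.
Local Open Scope complex_scope.

Arguments Normc.normc : simpl never.

(** * The modulus of a complex number *)

Lemma normcE (R : realType) (z : R[i]) : `|z| = (Normc.normc z)%:C.
Proof. by []. Qed.

Lemma normc_real (R : realType) (x : R) : Normc.normc (x%:C) = `|x|.
Proof. by rewrite /Normc.normc /= expr0n addr0 sqrtr_sqr. Qed.

Lemma normc_ge0 (R : realType) (z : R[i]) : 0 <= Normc.normc z.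
Proof. by case: z => a b; rewrite sqrtr_ge0. Qed.

Lemma normc_sqr (R : realType) (z : R[i]) :
  Normc.normc z ^+ 2 = complex.Re z ^+ 2 + complex.Im z ^+ 2.
Proof. by case: z => a b; rewrite /= sqr_sqrtr// addr_ge0// sqr_ge0. Qed.

Lemma normc_sqrE (R : realType) (z : R[i]) : (Normc.normc z ^+ 2)%:C = z * z^*%C.
Proof.
by rewrite normc_sqr; case: z => a b; simpc; congr (_ +i* _); ring.
Qed.

Lemma Re_mulconj_le (R : realType) (z w : R[i]) :
  `|complex.Re (z * w^*%C)| <= Normc.normc z ^+ 2 + Normc.normc w ^+ 2.
Proof.
rewrite !normc_sqr; case: z w => [a b] [c d]; simpc => /=.
have := (sqr_ge0 (a + c), sqr_ge0 (a - c), sqr_ge0 (b + d), sqr_ge0 (b - d)).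
have := (sqr_ge0 a, sqr_ge0 b, sqr_ge0 c, sqr_ge0 d).
rewrite !expr2 => -[[[? ?] ?] ?] [[[? ?] ?] ?].
by rewrite ler_norml; apply/andP; split; lra.
Qed.

Lemma Im_mulconj_le (R : realType) (z w : R[i]) :
  `|complex.Im (z * w^*%C)| <= Normc.normc z ^+ 2 + Normc.normc w ^+ 2.
Proof.
rewrite !normc_sqr; case: z w => [a b] [c d]; simpc => /=.
have := (sqr_ge0 (a + d), sqr_ge0 (a - d), sqr_ge0 (b + c), sqr_ge0 (b - c)).
have := (sqr_ge0 a, sqr_ge0 b, sqr_ge0 c, sqr_ge0 d).
rewrite !expr2 => -[[[? ?] ?] ?] [[[? ?] ?] ?].
by rewrite ler_norml; apply/andP; split; lra.
Qed.

Lemma normcX (R : realType) (z : R[i]) n : Normc.normc (z ^+ n) = Normc.normc z ^+ n.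
Proof. by elim: n => [|n IH]; rewrite ?expr0 ?Normc.normc1// !exprS Normc.normcM IH. Qed.

Lemma normc_conj (R : realType) (z : R[i]) : Normc.normc (z^*%C) = Normc.normc z.
Proof. by case: z => a b; rewrite /Normc.normc /= sqrrN. Qed.

Lemma normc_unit (R : realType) (c s : R) :
  c ^+ 2 + s ^+ 2 = 1 -> Normc.normc (c +i* s) = 1.
Proof. by move=> cs; rewrite /Normc.normc cs sqrtr1. Qed.

Lemma unit_expM_conj (R : realType) (u : R[i]) m n : Normc.normc u = 1 ->
  u ^+ (m + n) * (u ^+ n)^*%C = u ^+ m.
Proof.
move=> u1; rewrite exprD -mulrA -normc_sqrE normcX u1 expr1n expr1n.
by rewrite mulr1.
Qed.

Lemma conjc_oppreal (R : realType) (x : R) : ((- x%:C)^*)%C = - x%:C.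
Proof. by rewrite -rmorphN; apply/eqP; rewrite eq_complex /= oppr0 !eqxx. Qed.

(** * Rotations preserve Lebesgue measure *)

Definition preserving d (T : measurableType d) (R : realType)
    (mu : set T -> \bar R) (phi : T -> T) : Prop :=
  measurable_fun setT phi /\
  forall A, measurable A -> mu (phi @^-1` A) = mu A.

Lemma preserving_comp d (T : measurableType d) (R : realType)
    (mu : set T -> \bar R) (phi psi : T -> T) :
  preserving mu phi -> preserving mu psi -> preserving mu (phi \o psi).
Proof.
move=> [mphi hphi] [mpsi hpsi]; split; first exact: measurableT_comp.
move=> A mA; rewrite comp_preimage hpsi ?hphi//.
by rewrite -[X in measurable X]setTI; exact: mphi.
Qed.

(** The section at x of a preimage is the preimage of the section under
[tau x], so the claim is Fubini's formula for the product measure. *)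
Lemma preserving_fiberwise d1 d2 (X : measurableType d1) (Y : measurableType d2)
    (R : realType) (m1 : {measure set X -> \bar R})
    (m2 : {sigma_finite_measure set Y -> \bar R}) (tau : X -> Y -> Y) :
  measurable_fun setT (fun p : X * Y => (p.1, tau p.1 p.2)) ->
  (forall x, preserving m2 (tau x)) ->
  preserving (m1 \x m2)%E (fun p => (p.1, tau p.1 p.2)).
Proof.
move=> mtau htau; split => // A mA.
rewrite /product_measure1; apply: eq_integral => x _ /=.
transitivity (m2 (tau x @^-1` (xsection A x))).
  by congr (m2 _); apply/seteqP; split => y /=; rewrite /xsection /= !inE.
by apply (htau x).2; exact: measurable_xsection.
Qed.

(** The image of the product measure agrees with it on rectangles. *)
Lemma preserving_swap d (X : measurableType d) (R : realType)
    (m : {sigma_finite_measure set X -> \bar R}) :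
  preserving (m \x m)%E (fun p : X * X => (p.2, p.1)).
Proof.
set sw := fun p : X * X => (p.2, p.1).
have msw : measurable_fun setT sw.
  exact: measurable_fun_pair measurable_snd measurable_fst.
split => // A mA; symmetry.
apply: (@product_measure_unique _ _ _ _ _ m m
  (pushforward (m \x m)%E sw)) => // B C mB mC.
rewrite /= /pushforward.
have -> : sw @^-1` (B `*` C) = C `*` B.
  by apply/seteqP; split => -[x y] /= [].
by rewrite product_measure1E// muleC.
Qed.

(** Translation maps half-open intervals to half-open intervals of the same
length, and these determine Lebesgue measure. *)
Lemma preserving_translation (R : realType) (t : R) :
  preserving (@lebesgue_measure R) (fun x : measurableTypeR R => x + t).
Proof.
have mt : measurable_fun setT (fun x : measurableTypeR R => (x + t : measurableTypeR R)).
  by apply: measurable_funD => //; exact: measurable_cst.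
split => // A mA; symmetry.
apply: (@lebesgue_measure_unique R (pushforward lebesgue_measure
  (fun x : measurableTypeR R => (x + t : measurableTypeR R)))) => //.
move=> X /ocitvP[->|[[a b]/= ab ->]].
  by rewrite /= /pushforward preimage_set0 !measure0.
rewrite /pushforward.
have -> : (fun x : R => x + t) @^-1` `]a, b] = `]a - t, b - t]%classic.
  apply/seteqP; split => x /=; rewrite !in_itv/= ltrBlDr lerBrDr//.
by rewrite !lebesgue_measure_itv/= !lte_fin ltrD2r ab !EFinB /=; congr (_%:E); ring.
Qed.

Lemma Rintegral_preserving d (X : measurableType d) (R : realType)
    (mu : {measure set X -> \bar R}) (phi : X -> X) (D : set X) (f : X -> R) :
  preserving mu phi -> measurable D -> phi @^-1` D = D ->
  measurable_fun setT f -> mu.-integrable D (EFin \o (f \o phi)) ->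
  \int[mu]_(x in D) f (phi x) = \int[mu]_(x in D) f x.
Proof.
move=> [mphi hphi] mD phiD mf fint; rewrite /Rintegral; congr fine.
rewrite -[in LHS]phiD -(integral_pushforward mphi (f := EFin \o f)) => //; last 2 first.
- exact/measurable_EFinP.
- by rewrite phiD.
apply: eq_measure_integral => A mA AD; exact: hphi.
Qed.

Section rotation.
Variable R : realType.
Local Notation R2 := (measurableTypeR R * measurableTypeR R)%type.
Implicit Types (c s t : R) (p : R2).

Definition rotation c s p : R2 := (c * p.1 - s * p.2, s * p.1 + c * p.2).

Definition shear t p : R2 := (p.1, p.2 + t * p.1).

Lemma preserving_shear t : preserving (@lebesgue2 R) (shear t).
Proof.
apply: (@preserving_fiberwise _ _ _ _ R lebesgue_measure lebesgue_measure
  (fun x y => y + t * x)) => [|x]; last exact: preserving_translation.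
apply: measurable_fun_pair => //; apply: measurable_funD => //.
exact: measurable_funM.
Qed.

(** For s <> 0 the rotation is the product of the shears (x + t y, y),
(x, y + s x) and (x + t y, y), where t = (c - 1) / s. *)
Lemma preserving_rotation c s : s != 0 -> c ^+ 2 + s ^+ 2 = 1 ->
  preserving (@lebesgue2 R) (rotation c s).
Proof.
move=> s0 cs1; set t := (c - 1) / s; set sw := fun p : R2 => (p.2, p.1).
have psw : preserving (@lebesgue2 R) sw by exact: preserving_swap.
have phs u : preserving (@lebesgue2 R) (sw \o shear u \o sw).
  by do 2 apply: preserving_comp => //; exact: preserving_shear.
have -> : rotation c s = (sw \o shear t \o sw) \o shear s \o (sw \o shear t \o sw).
  have cE : c = t * s + 1 by rewrite /t divfK// subrK.
  have sE : - s = t * (c + 1).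
    by apply: (mulIf s0); rewrite mulrAC /t divfK//; lra.
  apply/funext => -[x y]; rewrite /rotation /shear /sw /=.
  by congr pair; rewrite -?mulNr ?sE cE; ring.
by apply: preserving_comp => //; apply: preserving_comp => //; exact: preserving_shear.
Qed.

Definition rotate1 c s (x : R2 * R2) : R2 * R2 := (rotation c s x.1, x.2).
Definition rotate2 c s (x : R2 * R2) : R2 * R2 := (x.1, rotation c s x.2).

Lemma measurable_rotation c s : measurable_fun setT (rotation c s).
Proof.
apply: measurable_fun_pair.
  by apply: measurable_funB; apply: measurable_funM.
by apply: measurable_funD; apply: measurable_funM.
Qed.

Lemma preserving_rotate2 c s : s != 0 -> c ^+ 2 + s ^+ 2 = 1 ->
  preserving (@lebesgue4 R) (rotate2 c s).
Proof.
move=> s0 cs1.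
apply: (@preserving_fiberwise _ _ _ _ R (@lebesgue2 R) (@lebesgue2 R)
  (fun=> rotation c s)) => [|x].
  apply: measurable_fun_pair => //.
  by apply: (measurableT_comp (measurable_rotation c s)).
exact: preserving_rotation.
Qed.

Lemma preserving_rotate1 c s : s != 0 -> c ^+ 2 + s ^+ 2 = 1 ->
  preserving (@lebesgue4 R) (rotate1 c s).
Proof.
move=> s0 cs1; pose sw := fun p : R2 * R2 => (p.2, p.1).
have psw : preserving (@lebesgue4 R) sw by exact: preserving_swap.
have -> : rotate1 c s = sw \o rotate2 c s \o sw by [].
exact: preserving_comp (preserving_comp psw (preserving_rotate2 s0 cs1)) psw.
Qed.

Lemma toC2_rotate1 c s x :
  toC2 (rotate1 c s x) = ((c +i* s) * (toC2 x).1, (toC2 x).2).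
Proof.
by rewrite /toC2 /rotation /=; simpc; rewrite [s * _ + _]addrC.
Qed.

Lemma toC2_rotate2 c s x :
  toC2 (rotate2 c s x) = ((toC2 x).1, (c +i* s) * (toC2 x).2).
Proof.
by rewrite /toC2 /rotation /=; simpc; rewrite [s * _ + _]addrC.
Qed.

(** A rotation by pi / (2 n): its n-th power is multiplication by the imaginary
unit. *)
Lemma exists_rotation n : (0 < n)%N -> exists c s : R,
  [/\ s != 0, c ^+ 2 + s ^+ 2 = 1 & (c +i* s) ^+ n != 1 :> R[i]].
Proof.
move=> n0; have nR : n%:R != 0 :> R by rewrite pnatr_eq0 -lt0n.
pose t : R := pi / (n * 2)%:R.
have DM k : (cos t +i* sin t) ^+ k = (cos (t *+ k) +i* sin (t *+ k)) :> R[i].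
  elim: k => [|k IH]; first by rewrite expr0 mulr0n cos0 sin0.
  by rewrite exprS IH mulrS cosD sinD; simpc; congr (_ +i* _); rewrite addrC.
exists (cos t), (sin t); split.
- rewrite gt_eqF// sin_gt0_pi// divr_gt0 ?pi_gt0 ?ltr0n ?muln_gt0 ?n0//=.
  rewrite ltr_pdivrMr ?ltr0n ?muln_gt0 ?n0// ltr_pMr ?pi_gt0//.
  by rewrite ltr1n; case: (n) n0.
- exact: cos2Dsin2.
- have -> : (cos t +i* sin t) ^+ n = 'i%C :> R[i].
    rewrite DM; have -> : t *+ n = pi / 2.
      rewrite /t -mulr_natr natrM; by field.
    by rewrite cos_pihalf sin_pihalf.
  by rewrite eq_complex /= oner_eq0 andbF.
Qed.

End rotation.

(** * The space of square integrable functions *)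

Section L2theory.
Context {R : realType}.
Local Notation C := R[i].
Local Notation C2 := (R[i] * R[i])%type.
Variable Omega : set C2.
Local Notation mu := (@lebesgue4 R).
Local Notation D := (toC2 @^-1` Omega).
Hypothesis mD : measurable D.

Definition cmeasurable (f : C2 -> C) : Prop :=
  measurable_fun D (fun x => complex.Re (f (toC2 x))) /\
  measurable_fun D (fun x => complex.Im (f (toC2 x))).

Definition sqnorm (f : C2 -> C) : R := fine (L2normsq Omega f).

Lemma cmeasurable_cst (c : C) : cmeasurable (fun=> c).
Proof. by split; exact: measurable_cst. Qed.

Lemma cmeasurableD f g : cmeasurable f -> cmeasurable g ->
  cmeasurable (fun z => f z + g z).
Proof.
move=> [fr fi] [gr gi]; split.
  under eq_fun do rewrite raddfD /=; exact: measurable_funD.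
under eq_fun do rewrite raddfD /=; exact: measurable_funD.
Qed.

Lemma cmeasurableM f g : cmeasurable f -> cmeasurable g ->
  cmeasurable (fun z => f z * g z).
Proof.
move=> [fr fi] [gr gi]; split.
  rewrite (_ : (fun x => _) = fun x => complex.Re (f (toC2 x)) * complex.Re (g (toC2 x))
    - complex.Im (f (toC2 x)) * complex.Im (g (toC2 x))); last first.
    by apply/funext => x; case: (f _) (g _) => [a b] [c d].
  by apply: measurable_funB; exact: measurable_funM.
rewrite (_ : (fun x => _) = fun x => complex.Re (f (toC2 x)) * complex.Im (g (toC2 x))
  + complex.Im (f (toC2 x)) * complex.Re (g (toC2 x))); last first.
  by apply/funext => x; case: (f _) (g _) => [a b] [c d] /=.
by apply: measurable_funD; exact: measurable_funM.
Qed.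

Lemma cmeasurable_conj f : cmeasurable f -> cmeasurable (fun z => (f z)^*%C).
Proof.
move=> [fr fi]; split.
  by rewrite (_ : (fun x => _) = fun x => complex.Re (f (toC2 x)))//;
    apply/funext => x; case: (f _).
rewrite (_ : (fun x => _) = fun x => - complex.Im (f (toC2 x))); last first.
  by apply/funext => x; case: (f _).
exact: measurable_funN.
Qed.

Lemma measurable_normc_sqr f : cmeasurable f ->
  measurable_fun D (fun x => Normc.normc (f (toC2 x)) ^+ 2).
Proof.
move=> [fr fi]; under eq_fun do rewrite normc_sqr.
by apply: measurable_funD; exact: measurable_funX.
Qed.

Lemma L2_cmeasurable f : L2 Omega f -> cmeasurable f. Proof. by case. Qed.

Lemma L2_integrable f : L2 Omega f ->
  mu.-integrable D (fun x => (Normc.normc (f (toC2 x)) ^+ 2)%:E).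
Proof.
move=> fL2; apply/integrableP; split.
  apply/measurable_EFinP; apply: measurable_normc_sqr; exact: L2_cmeasurable.
case: fL2 => _ _; apply: le_lt_trans; rewrite /L2normsq.
rewrite le_eqVlt; apply/orP; left; apply/eqP; apply: eq_integral => x _.
by rewrite gee0_abs// lee_fin sqr_ge0.
Qed.

Lemma L2P f : cmeasurable f ->
  mu.-integrable D (fun x => (Normc.normc (f (toC2 x)) ^+ 2)%:E) -> L2 Omega f.
Proof.
move=> [fr fi] /integrableP[_ h]; split => //; apply: le_lt_trans h.
rewrite /L2normsq le_eqVlt; apply/orP; left; apply/eqP; apply: eq_integral => x _.
by rewrite gee0_abs// lee_fin sqr_ge0.
Qed.

Lemma L2_le f (g : C2 -> R) : cmeasurable f ->
  mu.-integrable D (fun x => (g (toC2 x))%:E) ->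
  (forall z, Omega z -> Normc.normc (f z) ^+ 2 <= g z) -> L2 Omega f.
Proof.
move=> mf ig fg; apply: L2P => //; apply: le_integrable ig => //.
  by apply/measurable_EFinP; apply: measurable_normc_sqr.
move=> x Dx; rewrite lee_fin ger0_norm ?sqr_ge0//.
exact: le_trans (fg _ Dx) (ler_norm _).
Qed.

Lemma L2_conj f : L2 Omega f -> L2 Omega (fun z => (f z)^*%C).
Proof.
move=> fL.
apply: (@L2_le _ (fun z => Normc.normc (f z) ^+ 2) _ (L2_integrable fL)).
  exact: cmeasurable_conj (L2_cmeasurable fL).
by move=> z _; rewrite !normc_sqr; case: (f z) => a b /=; rewrite sqrrN.
Qed.

Lemma L2_boundedM (b f : C2 -> C) (M : R) : cmeasurable b ->
  (forall z, Omega z -> Normc.normc (b z) <= M) -> L2 Omega f ->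
  L2 Omega (fun z => b z * f z).
Proof.
move=> mb bM fL.
have := integrableZl mD (M ^+ 2) (L2_integrable fL) => iM.
apply: (@L2_le _ (fun z => M ^+ 2 * Normc.normc (f z) ^+ 2)).
- exact: cmeasurableM (L2_cmeasurable fL).
- by move: iM; apply: eq_integrable => // x _; rewrite EFinM.
- move=> z Oz; rewrite Normc.normcM exprMn ler_wpM2r ?sqr_ge0// lerXn2r//.
  + by rewrite nnegrE normc_ge0.
  + by rewrite nnegrE (le_trans _ (bM z Oz))// normc_ge0.
  + exact: bM.
Qed.

Lemma L2_lin (a : C) f g : L2 Omega f -> L2 Omega g ->
  L2 Omega (fun z => a * f z + g z).
Proof.
move=> fL gL.
have afL : L2 Omega (fun z => a * f z).
  by apply: (@L2_boundedM _ _ (Normc.normc a)) => //; exact: cmeasurable_cst.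
have := integrableZl mD 2 (integrableD mD (L2_integrable afL) (L2_integrable gL)) => i2.
apply: (@L2_le _ (fun z => 2 * (Normc.normc (a * f z) ^+ 2 + Normc.normc (g z) ^+ 2))).
- by apply: cmeasurableD; exact: L2_cmeasurable.
- by move: i2; apply: eq_integrable => // x _.
- move=> z _; rewrite !normc_sqr; case: (a * f z) (g z) => [x y] [u v] /=.
  have := (sqr_ge0 (x - u), sqr_ge0 (y - v)); rewrite !expr2 => -[? ?]; lra.
Qed.

Lemma L2_0 : L2 Omega (fun=> 0).
Proof.
split; [exact: measurable_cst| exact: measurable_cst|].
rewrite /L2normsq; under eq_integral do rewrite Normc.normc0 expr0n.
by rewrite integral0 ltry.
Qed.

Lemma integrable_Re f g : L2 Omega f -> L2 Omega g ->
  mu.-integrable D (fun x => (complex.Re (f (toC2 x) * (g (toC2 x))^*%C))%:E).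
Proof.
move=> fL gL.
apply: (le_integrable mD _ _ (integrableD mD (L2_integrable fL) (L2_integrable gL))).
  apply/measurable_EFinP.
  exact: (cmeasurableM (L2_cmeasurable fL) (cmeasurable_conj (L2_cmeasurable gL))).1.
move=> x _; rewrite -EFinD !abse_EFin lee_fin.
exact: le_trans (Re_mulconj_le _ _) (ler_norm _).
Qed.

Lemma integrable_Im f g : L2 Omega f -> L2 Omega g ->
  mu.-integrable D (fun x => (complex.Im (f (toC2 x) * (g (toC2 x))^*%C))%:E).
Proof.
move=> fL gL.
apply: (le_integrable mD _ _ (integrableD mD (L2_integrable fL) (L2_integrable gL))).
  apply/measurable_EFinP.
  exact: (cmeasurableM (L2_cmeasurable fL) (cmeasurable_conj (L2_cmeasurable gL))).2.
move=> x _; rewrite -EFinD !abse_EFin lee_fin.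
exact: le_trans (Im_mulconj_le _ _) (ler_norm _).
Qed.

Lemma L2inner_linl (a : C) f g h : L2 Omega f -> L2 Omega g -> L2 Omega h ->
  L2inner Omega (fun z => a * f z + g z) h =
    a * L2inner Omega f h + L2inner Omega g h.
Proof.
move=> fL gL hL.
have ifr := integrable_Re fL hL; have ifi := integrable_Im fL hL.
have igr := integrable_Re gL hL; have igi := integrable_Im gL hL.
have Z (r : R) (u : _ -> R) : mu.-integrable D (EFin \o u) ->
    mu.-integrable D (EFin \o (fun x => r * u x)).
  by move=> iu; have := integrableZl mD r iu; apply: eq_integrable => // x _ /=; rewrite EFinM.
have B (u v : _ -> R) : mu.-integrable D (EFin \o u) -> mu.-integrable D (EFin \o v) ->
    mu.-integrable D (EFin \o (fun x => u x - v x)).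
  by move=> iu iv; have := integrableB mD iu iv; apply: eq_integrable.
have A (u v : _ -> R) : mu.-integrable D (EFin \o u) -> mu.-integrable D (EFin \o v) ->
    mu.-integrable D (EFin \o (fun x => u x + v x)).
  by move=> iu iv; have := integrableD mD iu iv; apply: eq_integrable.
case: a => p q; rewrite /L2inner; simpc; congr (_ +i* _).
  rewrite -!RintegralZl// -RintegralB//; try by do ?[apply: B | apply: Z].
  rewrite -RintegralD//; try by do ?[apply: B | apply: Z].
  apply: eq_Rintegral => x _; case: (f _) (g _) (h _) => [? ?] [? ?] [? ?].
  by simpc => /=; ring.
rewrite -!RintegralZl// -!RintegralD//; try by do ?[apply: A | apply: Z].
apply: eq_Rintegral => x _; case: (f _) (g _) (h _) => [? ?] [? ?] [? ?].
by simpc => /=; ring.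
Qed.

Lemma L2innerC f g : L2 Omega f -> L2 Omega g ->
  L2inner Omega g f = (L2inner Omega f g)^*%C.
Proof.
move=> fL gL; rewrite /L2inner /=; congr (_ +i* _).
  by apply: eq_Rintegral => x _; case: (f _) (g _) => [? ?] [? ?]; simpc => /=; ring.
rewrite -[RHS]mulN1r -RintegralZl//; last exact: integrable_Im.
by apply: eq_Rintegral => x _; case: (f _) (g _) => [? ?] [? ?]; simpc => /=; ring.
Qed.

Lemma L2inner_linr (a : C) f g h : L2 Omega f -> L2 Omega g -> L2 Omega h ->
  L2inner Omega h (fun z => a * f z + g z) =
    a^*%C * L2inner Omega h f + L2inner Omega h g.
Proof.
move=> fL gL hL; have aL := L2_lin a fL gL.
by rewrite (L2innerC aL hL) L2inner_linl// rmorphD rmorphM (L2innerC fL hL) (L2innerC gL hL).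
Qed.

Lemma L2normsqE f : L2 Omega f -> L2normsq Omega f = (sqnorm f)%:E.
Proof.
case=> _ _ fL; rewrite /sqnorm fineK// ge0_fin_numE//.
by apply: integral_ge0 => x _; rewrite lee_fin sqr_ge0.
Qed.

Lemma sqnorm_ge0 f : 0 <= sqnorm f.
Proof. by apply: fine_ge0; apply: integral_ge0 => x _; rewrite lee_fin sqr_ge0. Qed.

Lemma L2inner_self f : L2inner Omega f f = (sqnorm f)%:C.
Proof.
rewrite /L2inner /sqnorm /L2normsq /Rintegral; congr (_ +i* _).
  congr fine; apply: eq_integral => x _; congr EFin.
  by rewrite normc_sqr; case: (f _) => a b; simpc => /=; ring.
under eq_integral.
  move=> x _; rewrite (_ : complex.Im _ = 0); last first.
    by case: (f _) => a b; simpc => /=; ring.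
  over.
by rewrite integral0.
Qed.

Lemma L2inner_ae f f' g : L2 Omega f -> L2 Omega f' -> L2 Omega g ->
  ae_eq_on Omega f f' -> L2inner Omega f g = L2inner Omega f' g.
Proof.
move=> fL f'L gL ff'; rewrite /L2inner /Rintegral; congr (_ +i* _); congr fine.
  apply: ae_eq_integral => //.
  - exact: measurable_int (integrable_Re fL gL).
  - exact: measurable_int (integrable_Re f'L gL).
  - by apply: filterS ff' => x h Dx; rewrite h.
apply: ae_eq_integral => //.
- exact: measurable_int (integrable_Im fL gL).
- exact: measurable_int (integrable_Im f'L gL).
- by apply: filterS ff' => x h Dx; rewrite h.
Qed.

End L2theory.

(** * Bessel's inequality and bounded functionals *)

Section hilbert.
Context {R : realType}.
Local Notation C := R[i].
Local Notation C2 := (R[i] * R[i])%type.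
Variable Omega : set C2.
Local Notation D := (toC2 @^-1` Omega).
Hypothesis mD : measurable D.
Local Notation "<[ f , g ]>" := (L2inner Omega f g).
Local Notation L2 := (L2 Omega).
Local Notation sqnorm := (sqnorm Omega).

Lemma sqnorm_lin (a : C) f g : L2 f -> L2 g ->
  sqnorm (fun z => a * f z + g z) =
    Normc.normc a ^+ 2 * sqnorm f + 2 * complex.Re (a * <[f, g]>) + sqnorm g.
Proof.
move=> fL gL; apply: (@complexI R); rewrite -L2inner_self.
have aL := L2_lin mD a fL gL.
rewrite L2inner_linl// !L2inner_linr// !L2inner_self// (L2innerC mD fL gL).
rewrite normc_sqr; case: a aL <[f, g]> => p q _ [u v]; simpc => /=.
by congr (_ +i* _); ring.
Qed.

Lemma sqnorm_project f w : L2 f -> L2 w ->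
  sqnorm (fun z => - (<[f, w]> / (sqnorm w)%:C) * w z + f z) =
    sqnorm f - Normc.normc <[f, w]> ^+ 2 / sqnorm w.
Proof.
move=> fL wL; rewrite sqnorm_lin// (L2innerC mD fL wL) !normc_sqr.
have -> : <[f, w]> / (sqnorm w)%:C = <[f, w]> * ((sqnorm w)^-1)%:C.
  by rewrite fmorphV.
case: <[f, w]> => u v; simpc => /=.
have [->|n0] := eqVneq (sqnorm w) 0; first by rewrite invr0 !mulr0; ring.
by field.
Qed.

(** The subtraction of the projections on the w j one at a time leaves a
remainder r that has the same inner product as g with everything orthogonal to
the vectors treated so far. Vectors w j of norm 0 are harmless: their term is
a division by 0, which is 0. *)
Lemma bessel (J : eqType) (w : J -> C2 -> C) (s : seq J) g :
  uniq s -> (forall j, j \in s -> L2 (w j)) ->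
  {in s &, forall i j, i != j -> <[w i, w j]> = 0} -> L2 g ->
  \sum_(j <- s) Normc.normc <[g, w j]> ^+ 2 / sqnorm (w j) <= sqnorm g.
Proof.
move=> us wL worth gL.
suff [r [rL -> _]] : exists r, [/\ L2 r,
    \sum_(j <- s) Normc.normc <[g, w j]> ^+ 2 / sqnorm (w j) = sqnorm g - sqnorm r
  & forall v, L2 v -> (forall j, j \in s -> <[w j, v]> = 0) -> <[r, v]> = <[g, v]>].
  by rewrite gerBl sqnorm_ge0.
elim: s us wL worth => [_ _ _|j s IH /=/andP[js us] wL worth].
  by exists g; rewrite big_nil subrr.
have [//|j' j's|i k iS ks|r [rL rE rv]] := IH.
- by apply: wL; rewrite inE j's orbT.
- by apply: worth; rewrite inE ?iS ?ks orbT.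
have jL : L2 (w j) by apply: wL; rewrite mem_head.
have rj : <[r, w j]> = <[g, w j]>.
  apply: rv => // i iS; apply: worth; rewrite ?mem_head// ?inE ?iS ?orbT//.
  by apply: contraNneq js => <-.
exists (fun z => - (<[r, w j]> / (sqnorm (w j))%:C) * w j z + r z); split.
- exact: L2_lin.
- by rewrite big_cons sqnorm_project// rE rj opprB addrCA.
- move=> v vL vorth; rewrite L2inner_linl// vorth ?mem_head// mulr0 add0r.
  by apply: rv => // i iS; apply: vorth; rewrite inE iS orbT.
Qed.

Lemma cauchy_schwarz f g : L2 f -> L2 g ->
  Normc.normc <[f, g]> ^+ 2 <= sqnorm f * sqnorm g.
Proof.
move=> fL gL.
have [g0|g0] := eqVneq (sqnorm g) 0; last first.
  have := @bessel unit (fun=> g) [:: tt] f isT (fun _ _ => gL).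
  rewrite big_seq1 ler_pdivrMr ?lt_def ?g0 ?sqnorm_ge0//.
  by apply => // -[] [].
rewrite g0 mulr0 leNgt; apply/negP; set n := (X in 0 < X) => n0.
(* since g has norm 0, the squared norm of f + c g is affine in c, and t is
   chosen to make it -1 *)
pose t := - (sqnorm f + 1) / (2 * n).
have := sqnorm_ge0 Omega (fun z => (t%:C * <[f, g]>) * g z + f z).
rewrite sqnorm_lin// (L2innerC mD fL gL) g0 mulr0 add0r.
rewrite -mulrA -normc_sqrE -/n -rmorphM/= /t.
have -> : 2 * (- (sqnorm f + 1) / (2 * n) * n) + sqnorm f = - 1.
  by field; rewrite gt_eqF.
by rewrite ler0N1.
Qed.

(** Stated for a predicate P so as to apply both to L2 inner products and to
functionals defined on the Bergman space only. *)
Lemma linear_sum (P : (C2 -> C) -> Prop) (l : (C2 -> C) -> C)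
    (I : eqType) (s : seq I) (c : I -> C) (e : I -> C2 -> C) :
  P (fun=> 0) ->
  (forall a f g, P f -> P g -> P (fun z => a * f z + g z)) ->
  (forall a f g, P f -> P g -> l (fun z => a * f z + g z) = a * l f + l g) ->
  (forall i, i \in s -> P (e i)) ->
  P (fun z => \sum_(i <- s) c i * e i z) /\
  l (fun z => \sum_(i <- s) c i * e i z) = \sum_(i <- s) c i * l (e i).
Proof.
move=> P0 Plin llin; elim: s => [_|i s IH Pe].
  under eq_fun do rewrite big_nil.
  split=> //; rewrite big_nil.
  have := llin 1 _ _ P0 P0; under eq_fun do rewrite mulr0 addr0.
  by rewrite mul1r => /esym/eqP; rewrite addrC -subr_eq0 addrK => /eqP.
under eq_fun do rewrite big_cons.
have [|Ps ls] := IH; first by move=> j js; apply: Pe; rewrite inE js orbT.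
have Pi : P (e i) by apply: Pe; rewrite mem_head.
by split; [exact: Plin | rewrite llin// ls big_cons].
Qed.

Lemma L2inner_suml (I : eqType) (s : seq I) (c : I -> C) (e : I -> C2 -> C) g :
  (forall i, i \in s -> L2 (e i)) -> L2 g ->
  L2 (fun z => \sum_(i <- s) c i * e i z) /\
  <[fun z => \sum_(i <- s) c i * e i z, g]> = \sum_(i <- s) c i * <[e i, g]>.
Proof.
move=> eL gL; apply: (@linear_sum L2 (fun f => <[f, g]>)) => //.
- exact: L2_0.
- by move=> a f h; exact: L2_lin.
- by move=> a f h fL hL; exact: L2inner_linl.
Qed.

Lemma L2_scale (a : C) f : L2 f -> L2 (fun z => a * f z).
Proof.
by move=> fL; apply: (@L2_boundedM _ _ mD _ _ (Normc.normc a)).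
Qed.

Lemma L2inner_Zl (a : C) f g : L2 f -> L2 g ->
  <[fun z => a * f z, g]> = a * <[f, g]>.
Proof.
move=> fL gL; have [|_] := @L2inner_suml _ [:: tt] (fun=> a) (fun=> f) g _ gL => //.
rewrite big_seq1 => <-; congr L2inner.
by apply/funext => z; rewrite big_seq1.
Qed.

Lemma L2inner_Zr (a : C) f g : L2 f -> L2 g ->
  <[f, fun z => a * g z]> = a^*%C * <[f, g]>.
Proof.
move=> fL gL; rewrite (L2innerC mD (L2_scale a gL) fL) L2inner_Zl// rmorphM.
by rewrite (L2innerC mD gL fL).
Qed.

Lemma holomorphic_lin (a : C) f g : holomorphic Omega f -> holomorphic Omega g ->
  holomorphic Omega (fun z => a * f z + g z).
Proof.
move=> hf hg z Oz; apply: differentiableD; last exact: hg.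
by apply: differentiableM; [exact: differentiable_cst | exact: hf].
Qed.

Lemma bergman_lin (a : C) f g : bergman Omega f -> bergman Omega g ->
  bergman Omega (fun z => a * f z + g z).
Proof.
by move=> [hf fL] [hg gL]; split; [exact: holomorphic_lin | exact: L2_lin].
Qed.

Lemma bergman0 : bergman Omega (fun=> 0).
Proof. by split; [move=> z _; exact: differentiable_cst | exact: L2_0]. Qed.

(** If f is within epsilon of a combination p of the e i, then
<f, m> = <f - p, m> is small by Cauchy-Schwarz. *)
Lemma orthogonal_complete (I : choiceType) (S : set I) (e : I -> C2 -> C) f m :
  complete_orthogonal_system Omega S e -> L2 m ->
  (forall i, S i -> <[e i, m]> = 0) -> bergman Omega f -> <[f, m]> = 0.
Proof.
move=> [eB _ dense] mL em0 fB; have [_ fL] := fB.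
apply/eqP/negPn/negP => fm0.
have n0 : 0 < Normc.normc <[f, m]> ^+ 2.
  rewrite exprn_gt0// lt_def normc_ge0 andbT.
  by apply: contraNneq fm0 => /Normc.eq0_normc ->.
have e0 : 0 < Normc.normc <[f, m]> ^+ 2 / (sqnorm m + 1).
  by rewrite divr_gt0// ltr_wpDl// sqnorm_ge0.
have [s [c [sS]]] := dense f fB _ e0.
have [|pL pE] := @L2inner_suml _ s c e m _ mL.
  by move=> i /sS /eB[[]].
have -> : (fun z => f z - \sum_(i <- s) c i * e i z) =
    (fun z => -1 * (\sum_(i <- s) c i * e i z) + f z).
  by apply/funext => z; rewrite mulN1r addrC.
have qL := L2_lin mD (-1) pL fL.
have := cauchy_schwarz qL mL.
rewrite L2inner_linl// pE big_seq big1 ?mulr0 ?add0r; last first.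
  by move=> i /sS Si; rewrite em0// mulr0.
rewrite L2normsqE// lte_fin ltr_pdivlMr ?ltr_wpDl ?sqnorm_ge0//.
have := sqnorm_ge0 Omega (fun z => -1 * (\sum_(i <- s) c i * e i z) + f z).
set q := sqnorm (fun z => -1 * _ + _); have := sqnorm_ge0 Omega m.
by nra.
Qed.

(** On a finite combination p of the xi i the functional l is the inner product
with u = sum conj(l (xi i)) xi i, whose squared norm is a partial sum of
sum |l (xi i)|^2 <= A. Boundedness of l extends the estimate to limits of such
combinations. This does the work of the adjoint of an operator and of
Parseval's identity. *)
Lemma functional_bound (I : choiceType) (xi : I -> C2 -> C)
    (l : (C2 -> C) -> C) (K A : R) g :
  orthonormal_basis Omega xi ->
  (forall (a : C) f h, bergman Omega f -> bergman Omega h ->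
     l (fun z => a * f z + h z) = a * l f + l h) ->
  (forall f, bergman Omega f -> Normc.normc (l f) ^+ 2 <= K * sqnorm f) ->
  (forall s : seq I, uniq s -> \sum_(i <- s) Normc.normc (l (xi i)) ^+ 2 <= A) ->
  bergman Omega g -> Normc.normc (l g) ^+ 2 <= A * sqnorm g.
Proof.
move=> [[xiB xiorth dense] xi1] llin lK lA gB.
have xiL i : L2 (xi i) by have [[]] := xiB i Logic.I.
have gL : L2 g by case: gB.
have A0 : 0 <= A by have := lA [::] isT; rewrite big_nil.
have normc_le (z : C) (r : R) : Normc.normc z ^+ 2 <= r -> Normc.normc z <= Num.sqrt r.
  move=> zr; rewrite -(@ler_pXn2r _ 2) ?nnegrE ?sqrtr_ge0 ?normc_ge0//.
  by rewrite sqr_sqrtr// (le_trans _ zr)// sqr_ge0.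
apply: (@le_trans _ _ ((Num.sqrt A * Num.sqrt (sqnorm g)) ^+ 2)); last first.
  by rewrite exprMn !sqr_sqrtr ?sqnorm_ge0.
rewrite ler_pXn2r ?nnegrE ?mulr_ge0 ?sqrtr_ge0 ?normc_ge0//.
apply/ler_addgt0Pr => e e0.
pose B := Num.sqrt `|K| + Num.sqrt A.
have B0 : 0 <= B by rewrite addr_ge0 ?sqrtr_ge0.
pose d := e / (B + 1).
have d0 : 0 < d by rewrite divr_gt0// ltr_wpDl.
have [s [c [_ sE]]] := dense g gB _ (exprn_gt0 2 d0).
have [|||pB lp] := @linear_sum (bergman Omega) l _ s c xi bergman0.
- by move=> a f h; exact: bergman_lin.
- exact: llin.
- by move=> i _; have [] := xiB i Logic.I.
move: pB lp sE; set p := (fun z => \sum_(i <- s) c i * xi i z) => pB lp.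
have pL : L2 p by case: pB.
pose q := fun z => -1 * p z + g z.
have -> : (fun z => g z - \sum_(i <- s) c i * xi i z) = q.
  by apply/funext => z; rewrite /q mulN1r addrC.
have qB : bergman Omega q by exact: bergman_lin.
have qL : L2 q by case: qB.
rewrite L2normsqE// lte_fin => qd.
have lg : l g = l q + l p.
  have -> : g = fun z => 1 * q z + p z by apply/funext => z; rewrite /q; ring.
  by rewrite llin// mul1r.
(* the Riesz representative of l on the span of the xi i with i in s; the
   sequence s may have repetitions *)
pose u := fun z => \sum_(i <- undup s) (l (xi i))^*%C * xi i z.
have uin v : L2 v -> L2 u /\
    <[u, v]> = \sum_(i <- undup s) (l (xi i))^*%C * <[xi i, v]>.
  by move=> vL; apply: L2inner_suml.
have uL : L2 u by case: (uin g gL).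
have xiu i : i \in s -> <[xi i, u]> = l (xi i).
  move=> iS; rewrite (L2innerC mD uL (xiL i)) (uin _ (xiL i)).2.
  rewrite (bigD1_seq i) ?undup_uniq ?mem_undup//= big1 ?addr0; last first.
    by move=> j ji; rewrite xiorth ?mulr0//; apply/eqP.
  by rewrite L2inner_self /sqnorm xi1 /= mulr1 conjcK.
have uA : sqnorm u <= A.
  apply: le_trans (lA _ (undup_uniq s)); rewrite le_eqVlt; apply/orP; left.
  apply/eqP/(@complexI R); rewrite -L2inner_self (uin u uL).2 rmorph_sum /=.
  rewrite big_seq [RHS]big_seq; apply: eq_bigr => i; rewrite mem_undup => iS.
  by rewrite normc_sqrE xiu// mulrC.
have pu : l p = <[p, u]>.
  rewrite lp; have [//|_ ->] := @L2inner_suml _ s c xi u _ uL.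
  by rewrite big_seq [RHS]big_seq; apply: eq_bigr => i /xiu ->.
have qu : <[p, u]> = <[g, u]> - <[q, u]>.
  by rewrite /q L2inner_linl//; ring.
have cs f : L2 f -> Normc.normc <[f, u]> <= Num.sqrt A * Num.sqrt (sqnorm f).
  move=> fL; rewrite -sqrtrM//; apply: normc_le.
  apply: le_trans (cauchy_schwarz fL uL) _.
  by rewrite mulrC ler_wpM2r ?sqnorm_ge0.
have lqK : Normc.normc (l q) <= Num.sqrt `|K| * Num.sqrt (sqnorm q).
  rewrite -sqrtrM//; apply: normc_le.
  by apply: le_trans (lK q qB) _; rewrite ler_wpM2r ?sqnorm_ge0// ler_norm.
have sqd : Num.sqrt (sqnorm q) <= d.
  by rewrite -[leRHS]ger0_norm ?(ltW d0)// -sqrtr_sqr ler_wsqrtr// ltW.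
rewrite lg pu qu.
apply: le_trans (le_normcD _ _) _; apply: le_trans (lerD lqK (le_normcD _ _)) _.
rewrite normcN; apply: le_trans (lerD (lexx _) (lerD (cs g gL) (cs q qL))) _.
rewrite addrCA lerD2l -mulrDl -/B.
apply: le_trans (ler_wpM2l B0 sqd) _.
by rewrite /d mulrCA ger_pMr// ler_pdivrMr ?ltr_wpDl// mul1r lerDl.
Qed.

(** For the functional g |-> <T g, w j>, [functional_bound] estimates
|<T (e j), w j>|^2 by |e j|^2 sum_i |<T (xi i), w j>|^2. Summing over j first,
Bessel's inequality applied to each T (xi i) bounds the total by
sum_i |T (xi i)|^2. *)
Lemma hilbert_schmidt_bound (T : (C2 -> C) -> (C2 -> C)) (J : choiceType)
    (e w : J -> C2 -> C) :
  hilbert_schmidt Omega T ->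
  (forall j, bergman Omega (e j)) -> (forall j, L2 (w j)) ->
  (forall i j, i != j -> <[w i, w j]> = 0) ->
  exists H : R, forall s : seq J, uniq s ->
    \sum_(j <- s) Normc.normc <[T (e j), w j]> ^+ 2 /
      (sqnorm (w j) * sqnorm (e j)) <= H.
Proof.
move=> [[TL Tlin [M TM]] [I [xi [xiONB TS]]]] eB wL worth.
have xiB i : bergman Omega (xi i) by case: xiONB => [[h _ _] _]; have [] := h i Logic.I.
pose S := (\esum_(i in [set: I]) L2normsq Omega (T (xi i)))%E.
pose d j := sqnorm (w j).
pose b j i := Normc.normc <[T (xi i), w j]> ^+ 2 / d j.
have b0 j i : 0 <= b j i by rewrite divr_ge0 ?sqr_ge0 ?sqnorm_ge0.
have bd g j : bergman Omega g ->
    Normc.normc <[T g, w j]> ^+ 2 = Normc.normc <[T g, w j]> ^+ 2 / d j * d j.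
  move=> gB; have [d0|d0] := eqVneq (d j) 0; last by rewrite divfK.
  have := cauchy_schwarz (TL g gB) (wL j); rewrite -/(d j) d0 !mulr0 => h.
  by apply/eqP; rewrite eq_le h sqr_ge0.
pose B j := (\esum_(i in [set: I]) (b j i)%:E)%E.
have sumB s : uniq s -> (\sum_(j <- s) B j <= S)%E.
  move=> us; rewrite -esum_sum; last by move=> i j _ _; rewrite lee_fin.
  apply: le_esum => i _; rewrite sumEFin L2normsqE ?TL//; last exact: TL.
  by rewrite lee_fin; apply: bessel => //; [move=> j j' _ _; exact: worth | exact: TL].
have Bfin j : B j = (fine (B j))%:E.
  rewrite fineK// ge0_fin_numE ?esum_ge0// => [|i _]; last by rewrite lee_fin.
  by apply: le_lt_trans TS; have := sumB [:: j] isT; rewrite big_seq1.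
have key j : Normc.normc <[T (e j), w j]> ^+ 2 <= (fine (B j) * d j) * sqnorm (e j).
  apply: (@functional_bound _ xi (fun g => <[T g, w j]>) (M ^+ 2 * d j)) => //.
  - move=> a f h fB hB.
    rewrite (L2inner_ae mD _ _ (wL j) (Tlin a f h fB hB)); last 2 first.
    + by apply: TL; exact: bergman_lin.
    + by apply: (L2_lin mD); exact: TL.
    by rewrite L2inner_linl//; exact: TL.
  - move=> f fB; apply: le_trans (cauchy_schwarz (TL f fB) (wL j)) _.
    rewrite -/(d j) mulrAC ler_wpM2r ?sqnorm_ge0//.
    have [_ fL] := fB.
    by have := TM f fB; rewrite (L2normsqE (TL f fB)) (L2normsqE fL) -EFinM lee_fin.
  - move=> s us; have -> : \sum_(i <- s) Normc.normc <[T (xi i), w j]> ^+ 2 =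
        (\sum_(i <- s) b j i) * d j.
      by rewrite mulr_suml; apply: eq_bigr => i _; exact: bd.
    rewrite ler_wpM2r ?sqnorm_ge0// -lee_fin -Bfin -sumEFin.
    apply: esum_ge; exists [set` s]; first by split => //; exact: finite_seq.
    by rewrite fsbig_seq//.
exists (fine S) => s us.
have S0 : (0 <= S)%E.
  by apply: esum_ge0 => i _; apply: integral_ge0 => x _; rewrite lee_fin sqr_ge0.
rewrite -lee_fin fineK ?ge0_fin_numE//.
apply: le_trans (sumB s us); rewrite -sumEFin; apply: lee_sum => j _.
rewrite Bfin lee_fin.
have [n0|n0] := eqVneq (sqnorm (w j) * sqnorm (e j)) 0.
  by rewrite n0 invr0 mulr0 fine_ge0// esum_ge0// => i _; rewrite lee_fin.
rewrite ler_pdivrMr; first by rewrite mulrA; exact: key.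
by rewrite lt_def n0 mulr_ge0// sqnorm_ge0.
Qed.

End hilbert.

(** * Cubes *)

Section cubes.
Variable R : realType.
Local Notation R2 := (measurableTypeR R * measurableTypeR R)%type.
Local Notation C2 := (R[i] * R[i])%type.

Definition cube (c : R2 * R2) (r : R) : set (R2 * R2) :=
  (`[c.1.1 - r, c.1.1 + r] `*` `[c.1.2 - r, c.1.2 + r]) `*`
  (`[c.2.1 - r, c.2.1 + r] `*` `[c.2.2 - r, c.2.2 + r]).

Lemma measurable_cube c r : measurable (cube c r).
Proof. by apply: measurableX; apply: measurableX; exact: measurable_itv. Qed.

Lemma lebesgue4_cube c r : 0 < r -> lebesgue4 (cube c r) = ((2 * r) ^+ 4)%:E.
Proof.
move=> r0; rewrite /cube /lebesgue4.
have mX (x y : R) : measurable ((`[x - r, x + r] : set (measurableTypeR R)) `*`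
    (`[y - r, y + r] : set (measurableTypeR R))).
  by apply: measurableX; exact: measurable_itv.
have l1 (x : R) : lebesgue_measure (`[x - r, x + r] : set (measurableTypeR R)) = (2 * r)%:E.
  rewrite lebesgue_measure_itv /= lte_fin ifT; last lra.
  by rewrite -EFinD; congr (_%:E); ring.
have l2 (x y : R) : lebesgue2 ((`[x - r, x + r] : set (measurableTypeR R)) `*`
    (`[y - r, y + r] : set (measurableTypeR R))) = ((2 * r) ^+ 2)%:E.
  have mI (w : R) : measurable (`[w - r, w + r] : set (measurableTypeR R)).
    exact: measurable_itv.
  rewrite /lebesgue2 (product_measure1E _ _ (mI x) (mI y)).
  by transitivity ((2 * r)%:E * (2 * r)%:E)%E;
    [congr (_ * _)%E; exact: l1 | rewrite -EFinM -expr2].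
rewrite (product_measure1E _ _ (mX _ _) (mX _ _)).
by transitivity (((2 * r) ^+ 2)%:E * ((2 * r) ^+ 2)%:E)%E;
  [congr (_ * _)%E; exact: l2 | rewrite -EFinM -exprD].
Qed.

Lemma nbhs_cube (z : C2) (A : set C2) : nbhs z A ->
  exists r : R, 0 < r /\
    cube ((complex.Re z.1, complex.Im z.1), (complex.Re z.2, complex.Im z.2)) r
      `<=` toC2 @^-1` A.
Proof.
case/nbhs_ballP => e /= e0 eA.
have [e' e'0 eE] : exists2 e' : R, 0 < e' & e = e'%:C.
  case: e e0 {eA} => a b; rewrite ltcE /= => /andP[/eqP b0 a0].
  by exists a => //; rewrite b0.
exists (e' / 4); split; first by rewrite divr_gt0.
have ncl (u v x y : R) : `|u - x| <= e' / 4 -> `|v - y| <= e' / 4 ->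
    `|(u +i* v) - (x +i* y)| < e.
  move=> ux vy; rewrite eE -[X in X < _]/((Normc.normc _)%:C) ltcR /=.
  apply: (@le_lt_trans _ _ (e' / 4 + e' / 4)); last by rewrite -mulrDl; lra.
  have k0 : 0 <= e' / 4 by rewrite divr_ge0// ltW.
  have sq (t : R) : `|t| <= e' / 4 -> t ^+ 2 <= (e' / 4) ^+ 2.
    by move=> tk; rewrite -[t ^+ 2]ger0_norm ?sqr_ge0// normrX lerXn2r.
  rewrite -[leRHS]ger0_norm ?addr_ge0// -sqrtr_sqr ler_wsqrtr//.
  by have := sq _ ux; have := sq _ vy; move: k0; nra.
move=> [[x1 y1] [x2 y2]] /= [[]]; rewrite /= !in_itv/=.
move=> /andP[h1 h2] /andP[h3 h4] [] /andP[h5 h6] /andP[h7 h8]; apply: eA.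
case: z h1 h2 h3 h4 h5 h6 h7 h8 => -[a b] [c d] /= h1 h2 h3 h4 h5 h6 h7 h8.
by split; apply: ncl; rewrite /= ler_distl; apply/andP; split; lra.
Qed.
End cubes.

(** A continuous function that is nonzero at z is bounded below in modulus on a
cube around z, which has positive measure. *)
Lemma bergman_eq0 (R : realType) (Omega : set (R[i] * R[i])) m :
  open Omega -> measurable (toC2 @^-1` Omega) -> bergman Omega m ->
  sqnorm Omega m = 0 -> forall z, Omega z -> m z = 0.
Proof.
move=> oO mD [hm mL] m0 z Oz; apply: contrapT => /eqP mz.
have e0 : 0 < Normc.normc (m z) / 2.
  rewrite divr_gt0// lt_def normc_ge0 andbT.
  by apply: contraNneq mz => /Normc.eq0_normc ->.
set e := Normc.normc (m z) / 2 in e0.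
have nearz : nbhs z (Omega `&` [set w | e <= Normc.normc (m w)]).
  apply: filterI; first exact: open_nbhs_nbhs.
  have /differentiable_continuous mc := hm z Oz.
  have e0C : 0 < e%:C :> R[i] by rewrite ltcR.
  move: (mc) => /cvgrPdist_lt /(_ _ e0C).
  apply: filterS => w /=; rewrite normcE ltcR => mzw.
  have := le_normcD (m z - m w) (m w); rewrite subrK => tri.
  have mzE : Normc.normc (m z) = e + e by rewrite /e; lra.
  by move: tri mzw mzE; set x := Normc.normc _; lra.
have [r [r0 rD]] := nbhs_cube nearz.
set E := cube _ _ in rD.
have mE : measurable E by exact: measurable_cube.
have ED : E `<=` toC2 @^-1` Omega by move=> x /rD[].
have : (lebesgue4 E * (e ^+ 2)%:E <= L2normsq Omega m)%E.
  have -> : (lebesgue4 E * (e ^+ 2)%:E = \int[lebesgue4]_(x in E) (e ^+ 2)%:E)%E.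
    by rewrite muleC; exact/esym/integral_cst.
  have mf : measurable_fun (toC2 @^-1` Omega)
      (fun x => (Normc.normc (m (toC2 x)) ^+ 2)%:E).
    by apply/measurable_EFinP; apply: measurable_normc_sqr; exact: L2_cmeasurable.
  apply: (le_trans _ (ge0_subset_integral lebesgue4 mE mD mf _ ED)); last first.
    by move=> x _; rewrite lee_fin sqr_ge0.
  apply: ge0_le_integral => //.
  - by move=> x _; rewrite lee_fin sqr_ge0.
  - exact: measurable_funS mf.
  move=> x /rD[_ ex]; rewrite lee_fin lerXn2r ?nnegrE ?normc_ge0//.
  exact: ltW.
rewrite L2normsqE// m0 /E lebesgue4_cube// -EFinM lee_fin leNgt.
by rewrite mulr_gt0// exprn_gt0// mulr_gt0.
Qed.

(** * Monomials on a complete Reinhardt Hartogs domain *)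

Section measurable_monomials.
Context {R : realType}.
Local Notation C := R[i].
Local Notation C2 := (R[i] * R[i])%type.
Variable Omega : set C2.
Hypothesis mD : measurable (toC2 @^-1` Omega).

Lemma cmeasurable_coord1 : cmeasurable Omega (fun z => z.1).
Proof. by split; apply: measurable_funTS; exact: measurableT_comp. Qed.

Lemma cmeasurable_coord2 : cmeasurable Omega (fun z => z.2).
Proof. by split; apply: measurable_funTS; exact: measurableT_comp. Qed.

Lemma cmeasurableX f n : cmeasurable Omega f -> cmeasurable Omega (fun z => f z ^+ n).
Proof.
move=> mf; elim: n => [|n IH]; first exact: cmeasurable_cst.
by under eq_fun do rewrite exprS; exact: cmeasurableM.
Qed.

Lemma cmeasurable_monomial a : cmeasurable Omega (monomial a).
Proof.
by apply: cmeasurableM => //; apply: cmeasurableX;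
  [exact: cmeasurable_coord1 | exact: cmeasurable_coord2].
Qed.

End measurable_monomials.

Section hartogs_domain.
Context {R : realType}.
Local Notation C := R[i].
Local Notation C2 := (R[i] * R[i])%type.
Variable phi : C -> R.
Local Notation Omega := (hartogs phi).
Local Notation mu := (@lebesgue4 R).
Local Notation D := (toC2 @^-1` Omega).
Hypothesis Omega_reinhardt : complete_reinhardt Omega.

Lemma hartogsP z : Omega z <->
  Normc.normc z.1 < 1 /\ Normc.normc z.2 < expR (- phi z.1).
Proof. by rewrite /hartogs /= !normcE -[1]/(1%:C) !ltcR. Qed.

Lemma reinhardt_normc z w : Omega z -> Normc.normc w.1 <= Normc.normc z.1 ->
  Normc.normc w.2 <= Normc.normc z.2 -> Omega w.
Proof. by move=> Oz w1 w2; apply: Omega_reinhardt Oz _ _; rewrite !normcE lecR. Qed.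

(** The bound on z2 comes from the point (0, z2), which is in the domain. *)
Lemma hartogs_bounded z : Omega z ->
  Normc.normc z.1 <= 1 /\ Normc.normc z.2 <= expR (- phi 0).
Proof.
move=> Oz; have [/ltW z1 _] := (hartogsP z).1 Oz; split => //.
have /hartogsP[/= _ /ltW] // : Omega (0, z.2).
by apply: (reinhardt_normc Oz) => //; rewrite -[(0, z.2).1]/(0 : C) Normc.normc0 normc_ge0.
Qed.

Lemma measurable_normc1 : measurable_fun setT (fun x => Normc.normc (@toC2 R x).1).
Proof.
rewrite /Normc.normc /=; apply: measurableT_comp.
  by apply: continuous_measurable_fun; exact: sqrt_continuous.
by apply: measurable_funD; apply: measurable_funX; exact: measurableT_comp.
Qed.

Lemma measurable_normc2 : measurable_fun setT (fun x => Normc.normc (@toC2 R x).2).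
Proof.
rewrite /Normc.normc /=; apply: measurableT_comp.
  by apply: continuous_measurable_fun; exact: sqrt_continuous.
by apply: measurable_funD; apply: measurable_funX; exact: measurableT_comp.
Qed.

(** The domain is the union over the rationals q of the sets where |z2| < q and
(|z1|, q) is in the domain; for fixed q the latter condition restricts |z1| to
an interval. *)
Lemma measurable_hartogs : measurable D.
Proof.
pose J (q : rat) : set R := [set r | 0 <= r /\ Omega (r%:C, (ratr q : R)%:C)].
have mJ q : measurable (J q).
  apply: is_interval_measurable => x y [x0 _] [y0 Oy] z /andP[xz zy]; split.
    exact: le_trans xz.
  apply: (reinhardt_normc Oy) => //=.
  by rewrite !normc_real !ger0_norm// (le_trans x0).
have -> : D = \bigcup_(q : rat) [set x | Normc.normc (toC2 x).2 < ratr q /\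
    J q (Normc.normc (toC2 x).1)].
  apply/seteqP; split => x.
    move=> Ox; have [x1 x2] := (hartogsP _).1 Ox.
    have [q] := rat_in_itvoo x2; rewrite in_itv/= => /andP[xq qphi].
    have q0 : 0 <= ratr q :> R by apply: le_trans (normc_ge0 _) (ltW xq).
    exists q => //; split => //; split; first exact: normc_ge0.
    have Oq : Omega ((toC2 x).1, (ratr q)%:C).
      by apply/hartogsP; split => //; rewrite normc_real ger0_norm.
    by apply: (reinhardt_normc Oq) => //; rewrite normc_real ger0_norm ?normc_ge0.
  move=> [q _ [xq [x0 Oq]]]; apply: (reinhardt_normc Oq).
    by rewrite normc_real ger0_norm ?normc_ge0.
  by rewrite normc_real (le_trans (ltW xq))// ler_norm.
apply: bigcupT_measurable_rat => q; apply: measurableI.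
  rewrite -[X in measurable X]setTI.
  exact: (measurable_fun_ltr measurable_normc2 (measurable_cst _)
    measurableT (Y := [set true])).
by rewrite -[X in measurable X]setTI; exact: measurable_normc1.
Qed.

Let mD := measurable_hartogs.

Lemma hartogs_finite : (mu D < +oo)%E.
Proof.
pose B := 1 + expR (- phi 0).
have B0 : 0 < B by rewrite addr_gt0// expR_gt0.
have le_mu : (mu D <= mu (cube ((0%R, 0%R), (0%R, 0%R)) B))%E.
  apply: le_measure; rewrite ?inE//; first exact: measurable_cube.
  move=> [[x1 y1] [x2 y2]] /hartogs_bounded /= [b1 b2].
  have comp (a b c : R) : Num.sqrt (a ^+ 2 + b ^+ 2) <= c -> c <= B ->
      (- B <= a <= B) && (- B <= b <= B).
    move=> abc cB; rewrite -!ler_norml; apply/andP; split;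
      apply: le_trans cB; apply: le_trans abc;
      by rewrite -sqrtr_sqr ler_wsqrtr// ?lerDl ?lerDr sqr_ge0.
  have /andP[h1 h2] := comp _ _ _ b1 ltac:(by rewrite lerDl expR_ge0).
  have /andP[h3 h4] := comp _ _ _ b2 ltac:(by rewrite lerDr).
  by split; split; rewrite /= in_itv/= !add0r.
by apply: le_lt_trans le_mu _; rewrite lebesgue4_cube ?ltry.
Qed.

Lemma L2_bounded f (M : R) : cmeasurable Omega f ->
  (forall z, Omega z -> Normc.normc (f z) <= M) -> L2 Omega f.
Proof.
move=> mf fM; have L1 : L2 Omega (fun=> 1).
  apply: L2P; first exact: cmeasurable_cst.
  rewrite Normc.normc1 expr1n.
  apply/integrableP; split; first exact: measurable_cst.
  by rewrite integral_cst// normr1 mul1e hartogs_finite.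
have := L2_boundedM mD mf fM L1.
by under eq_fun do rewrite mulr1.
Qed.

Lemma monomial_bounded a : exists M : R,
  forall z, Omega z -> Normc.normc (monomial a z) <= M.
Proof.
exists (expR (- phi 0) ^+ a.2) => z /hartogs_bounded[z1 z2].
rewrite /monomial Normc.normcM !normcX -[leRHS]mul1r ler_pM ?exprn_ge0 ?normc_ge0//.
  by rewrite exprn_ile1// normc_ge0.
by rewrite lerXn2r// ?nnegrE ?normc_ge0 ?expR_ge0.
Qed.

Lemma L2_monomialM a f : L2 Omega f -> L2 Omega (fun z => monomial a z * f z).
Proof.
move=> fL; have [M hM] := monomial_bounded a.
by apply: (L2_boundedM mD _ hM fL); exact: cmeasurable_monomial.
Qed.

Lemma L2_monomial a : L2 Omega (monomial a).
Proof.
have [M hM] := monomial_bounded a; apply: L2_bounded hM.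
exact: cmeasurable_monomial.
Qed.

Lemma holomorphic_monomial a : holomorphic Omega (monomial a).
Proof.
have X (g : C2 -> C) n z : differentiable g z -> differentiable (fun w => g w ^+ n) z.
  move=> dg; elim: n => [|n IH]; first exact: differentiable_cst.
  by under eq_fun do rewrite exprS; exact: differentiableM.
have d1 z : differentiable (fun z : C2 => z.1 : C) z.
  by apply: (@linear_differentiable _ _ _ (@fst C C)) => x; exact: cvg_fst.
have d2 z : differentiable (fun z : C2 => z.2 : C) z.
  by apply: (@linear_differentiable _ _ _ (@snd C C)) => x; exact: cvg_snd.
by move=> z _; apply: differentiableM; apply: X.
Qed.

Lemma bergman_monomial a : bergman Omega (monomial a).
Proof. by split; [exact: holomorphic_monomial | exact: L2_monomial]. Qed.

End hartogs_domain.

Section preserving_inner.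
Context {R : realType}.
Local Notation C := R[i].
Local Notation C2 := (R[i] * R[i])%type.
Variable Omega : set C2.
Local Notation mu := (@lebesgue4 R).
Local Notation D := (toC2 @^-1` Omega).
Hypothesis mD : measurable D.

Lemma L2inner_preserving rho (T : C2 -> C2) f g :
  preserving mu rho -> (forall x, toC2 (rho x) = T (toC2 x)) ->
  (forall z, Omega (T z) <-> Omega z) ->
  cmeasurable setT f -> cmeasurable setT g ->
  L2 Omega (f \o T) -> L2 Omega (g \o T) ->
  L2inner Omega (f \o T) (g \o T) = L2inner Omega f g.
Proof.
move=> prho rhoT OT mf mg fL gL; rewrite /L2inner.
have rD : rho @^-1` D = D.
  by apply/seteqP; split => x /=; rewrite rhoT => /OT.
have [mr mi] := cmeasurableM mf (cmeasurable_conj mg).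
rewrite preimage_setT in mr mi.
have := integrable_Re mD fL gL; have := integrable_Im mD fL gL.
under eq_fun do rewrite /= -!rhoT; move=> ii.
under eq_fun do rewrite /= -!rhoT; move=> ir.
congr (_ +i* _).
  rewrite -[RHS](Rintegral_preserving prho mD rD mr ir).
  by apply: eq_Rintegral => x _; rewrite /= rhoT.
rewrite -[RHS](Rintegral_preserving prho mD rD mi ii).
by apply: eq_Rintegral => x _; rewrite /= rhoT.
Qed.
End preserving_inner.

Section monomials.
Context {R : realType}.
Local Notation C := R[i].
Local Notation C2 := (R[i] * R[i])%type.
Variable phi : C -> R.
Local Notation Omega := (hartogs phi).
Local Notation mu := (@lebesgue4 R).
Local Notation D := (toC2 @^-1` Omega).
Hypothesis Omega_reinhardt : complete_reinhardt Omega.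
Let mD := measurable_hartogs Omega_reinhardt.
Let monL a := L2_monomial Omega_reinhardt a.
Local Notation "<[ f , g ]>" := (L2inner Omega f g).

Lemma cmeasurable_monomialT a : cmeasurable [set: C2] (monomial a).
Proof. by apply: cmeasurable_monomial; rewrite preimage_setT. Qed.

(** A measure preserving T that multiplies z^e by u^(d e), |u| = 1, multiplies
<z^a, z^b> by u^(d a - d b) while leaving it unchanged. *)
Lemma orthogonal_of_rotation rho (T : C2 -> C2) (u : C) (d : nat * nat -> nat) a b :
  preserving mu rho -> (forall x, toC2 (rho x) = T (toC2 x)) ->
  (forall z, Omega (T z) <-> Omega z) -> Normc.normc u = 1 ->
  (forall e, monomial e \o T = fun z => u ^+ d e * monomial e z) ->
  (d b < d a)%N -> u ^+ (d a - d b) != 1 -> <[monomial a, monomial b]> = 0.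
Proof.
move=> prho rhoT OT uu monT ba u1.
have monTL e : L2 Omega (monomial e \o T).
  by rewrite monT; apply: L2_scale => //; exact: monL.
have wE : <[monomial a, monomial b]> = u ^+ (d a - d b) * <[monomial a, monomial b]>.
  rewrite -{1}(L2inner_preserving mD prho rhoT OT (cmeasurable_monomialT a)
    (cmeasurable_monomialT b))//.
  rewrite !monT L2inner_Zl//; last exact: L2_scale.
  rewrite L2inner_Zr// mulrA -{1}(subnK (ltnW ba)).
  by rewrite unit_expM_conj.
move/eqP: wE; rewrite -subr_eq0 -{1}[<[_, _]>]mul1r -mulrBl mulf_eq0.
by rewrite subr_eq0 eq_sym (negPf u1) /= => /eqP.
Qed.

Lemma monomial_orthogonal a b : a != b -> <[monomial a, monomial b]> = 0.
Proof.
have OT (u : C) (T : C2 -> C2) : Normc.normc u = 1 ->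
    (forall z, Normc.normc (T z).1 = Normc.normc z.1) ->
    (forall z, Normc.normc (T z).2 = Normc.normc z.2) ->
    forall z, Omega (T z) <-> Omega z.
  move=> uu T1 T2 z.
  by split => Oz; apply: (reinhardt_normc Omega_reinhardt Oz); rewrite ?T1 ?T2.
have orth1 (a' b' : nat * nat) : (b'.1 < a'.1)%N -> <[monomial a', monomial b']> = 0.
  move=> ba; have [|c [s [s0 cs u1]]] := @exists_rotation R (a'.1 - b'.1).
    by rewrite subn_gt0.
  have uu := normc_unit cs.
  apply: (orthogonal_of_rotation (preserving_rotate1 s0 cs)
    (T := fun z => ((c +i* s) * z.1, z.2)) (d := fst) _ _ uu) => //.
  - exact: toC2_rotate1.
  - by apply: (OT _ _ uu) => // z; rewrite Normc.normcM uu mul1r.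
  - by move=> e; apply/funext => z; rewrite /= /monomial exprMn mulrA.
have orth2 (a' b' : nat * nat) : (b'.2 < a'.2)%N -> <[monomial a', monomial b']> = 0.
  move=> ba; have [|c [s [s0 cs u1]]] := @exists_rotation R (a'.2 - b'.2).
    by rewrite subn_gt0.
  have uu := normc_unit cs.
  apply: (orthogonal_of_rotation (preserving_rotate2 s0 cs)
    (T := fun z => (z.1, (c +i* s) * z.2)) (d := snd) _ _ uu) => //.
  - exact: toC2_rotate2.
  - by apply: (OT _ _ uu) => // z; rewrite Normc.normcM uu mul1r.
  - by move=> e; apply/funext => z; rewrite /= /monomial exprMn mulrCA.
have sym (a' b' : nat * nat) : <[monomial b', monomial a']> = 0 ->
    <[monomial a', monomial b']> = 0.
  by move=> h; rewrite (L2innerC mD (monL b') (monL a')) h rmorph0.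
case: a b => [a1 a2] [b1 b2]; rewrite xpair_eqE negb_and => /orP[|].
  by rewrite neq_ltn => /orP[h|h]; [apply: sym|]; exact: orth1.
by rewrite neq_ltn => /orP[h|h]; [apply: sym|]; exact: orth2.
Qed.

(** With h small enough for the polydisc of radius h to lie in the domain, the
cube where all four real coordinates are in [h / 4, h / 2] does too, and there
both |z1| and |z2| are at least h / 4. *)
Lemma sqnorm_monomial_ge : exists v s : R, [/\ 0 < v, 0 < s &
  forall a : nat * nat, v * s ^+ (a.1 + a.2) <= sqnorm Omega (monomial a)].
Proof.
pose h : R := Num.min (1 / 2) (expR (- phi (1 / 2)%:C) / 2).
have h0 : 0 < h by rewrite lt_min !divr_gt0// expR_gt0.
pose E := cube ((3 * h / 8, 3 * h / 8), (3 * h / 8, 3 * h / 8)) (h / 8).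
have hO : Omega (h%:C, h%:C).
  have O2 : Omega ((1 / 2)%:C, (expR (- phi (1 / 2)%:C) / 2)%:C).
    apply/hartogsP; rewrite /= !normc_real !ger0_norm ?divr_ge0 ?expR_ge0//.
    by have := expR_gt0 (- phi (1 / 2)%:C); split; lra.
  apply: (reinhardt_normc Omega_reinhardt O2); rewrite !normc_real !ger0_norm//;
    rewrite ?(ltW h0) ?divr_ge0 ?expR_ge0// /h ge_min lexx ?orbT//.
have ED x : E x -> [/\ Omega (toC2 x), h / 4 <= Normc.normc (toC2 x).1 &
    h / 4 <= Normc.normc (toC2 x).2].
  have comp (p q : R) : 3 * h / 8 - h / 8 <= p <= 3 * h / 8 + h / 8 ->
      3 * h / 8 - h / 8 <= q <= 3 * h / 8 + h / 8 ->
      h / 4 <= Num.sqrt (p ^+ 2 + q ^+ 2) <= h.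
    move=> /andP[p1 p2] /andP[q1 q2]; apply/andP; split.
      have -> : h / 4 = Num.sqrt ((h / 4) ^+ 2).
        by rewrite sqrtr_sqr ger0_norm// divr_ge0// ltW.
      by rewrite ler_wsqrtr//; nra.
    rewrite -[leRHS]ger0_norm ?(ltW h0)// -sqrtr_sqr ler_wsqrtr//.
    by nra.
  case: x => -[x1 y1] [x2 y2] [[]] /=; rewrite !in_itv/= => hx1 hy1 [hx2 hy2].
  have /andP[l1 u1] := comp _ _ hx1 hy1; have /andP[l2 u2] := comp _ _ hx2 hy2.
  split => //; apply: (reinhardt_normc Omega_reinhardt hO);
    by rewrite normc_real (ger0_norm (ltW h0)).
exists ((2 * (h / 8)) ^+ 4), ((h / 4) ^+ 2); split.
- by rewrite exprn_gt0// mulr_gt0// divr_gt0.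
- by rewrite exprn_gt0// divr_gt0.
move=> a; rewrite -lee_fin -L2normsqE// /L2normsq.
have mE : measurable E by exact: measurable_cube.
apply: (@le_trans _ _ (\int[mu]_(x in E) (((h / 4) ^+ 2) ^+ (a.1 + a.2))%:E)%E).
  have -> : (\int[mu]_(x in E) (((h / 4) ^+ 2) ^+ (a.1 + a.2))%:E =
      (((h / 4) ^+ 2) ^+ (a.1 + a.2))%:E * mu E)%E by exact: integral_cst.
  by rewrite /E lebesgue4_cube ?divr_gt0// EFinM muleC.
have mf : measurable_fun D (fun x => (Normc.normc (monomial a (toC2 x)) ^+ 2)%:E).
  by apply/measurable_EFinP; apply: measurable_normc_sqr; exact: cmeasurable_monomial.
have EsD : E `<=` D by move=> x /ED[].
apply: (le_trans _ (ge0_subset_integral mu mE mD mf _ EsD)); last first.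
  by move=> x _; rewrite lee_fin sqr_ge0.
apply: ge0_le_integral => //.
- by move=> x _; rewrite lee_fin exprn_ge0// sqr_ge0.
- exact: measurable_funS mf.
move=> x /ED[_ x1 x2]; rewrite lee_fin /monomial Normc.normcM !normcX.
have k0 : 0 <= h / 4 by rewrite divr_ge0// ltW.
rewrite exprAC exprD lerXn2r ?nnegrE ?mulr_ge0 ?exprn_ge0 ?normc_ge0//.
by rewrite ler_pM ?exprn_ge0// lerXn2r ?nnegrE ?normc_ge0.
Qed.
End monomials.

(** * The Hankel operator with symbol the conjugate of a monomial *)

Lemma L2inner_conjMl (R : realType) (Omega : set (R[i] * R[i])) h f g :
  L2inner Omega (fun z => (h z)^*%C * f z) g = L2inner Omega f (fun z => h z * g z).
Proof.
by rewrite /L2inner; congr (_ +i* _); apply: eq_Rintegral => x _;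
  rewrite rmorphM mulrCA mulrA.
Qed.

Lemma L2inner_Ml (R : realType) (Omega : set (R[i] * R[i])) h f g :
  L2inner Omega (fun z => h z * f z) g =
  L2inner Omega f (fun z => (h z)^*%C * g z).
Proof.
rewrite -L2inner_conjMl; congr L2inner.
by apply/funext => z; rewrite conjcK.
Qed.

Section multi_index.
Implicit Types a b : nat * nat.
Definition addm a b := (a.1 + b.1, a.2 + b.2)%N.
Definition subm a b := (a.1 - b.1, a.2 - b.2)%N.
Definition leqm a b := (a.1 <= b.1)%N && (a.2 <= b.2)%N.

Lemma addmC a b : addm a b = addm b a.
Proof. by rewrite /addm addnC [(a.2 + _)%N]addnC. Qed.

Lemma submK a b : leqm a b -> addm a (subm b a) = b.
Proof. by case: a b => [a1 a2] [b1 b2] /andP[/= h1 h2]; rewrite /addm /= !subnKC. Qed.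

Lemma leqm_addr a b : leqm a (addm a b).
Proof. by rewrite /leqm !leq_addr. Qed.

Lemma addmK a b : subm (addm a b) a = b.
Proof. by case: b => ? ?; rewrite /subm /addm /= !addKn. Qed.

Lemma addmI a : injective (addm a).
Proof. by move=> b c abc; rewrite -(addmK a b) abc addmK. Qed.

Lemma monomialD (R : realType) a b (z : R[i] * R[i]) :
  monomial (addm a b) z = monomial a z * monomial b z.
Proof. by rewrite /monomial /= !exprD mulrACA. Qed.

Lemma monomial_mul (R : realType) a b :
  (fun z : R[i] * R[i] => monomial a z * monomial b z) = monomial (addm a b).
Proof. by apply/funext => z; rewrite monomialD. Qed.
End multi_index.

Section hankel_monomials.
Context {R : realType}.
Local Notation C := R[i].
Local Notation C2 := (R[i] * R[i])%type.
Variable phi : C -> R.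
Local Notation Omega := (hartogs phi).
Hypothesis Omega_reinhardt : complete_reinhardt Omega.
Hypothesis monomials_complete : exists S : set (nat * nat),
       complete_orthogonal_system Omega S monomial.
Let mD := measurable_hartogs Omega_reinhardt.
Let monL a := L2_monomial Omega_reinhardt a.
Local Notation "<[ f , g ]>" := (L2inner Omega f g).
Local Notation N a := (sqnorm Omega (monomial a)).

Lemma sqnorm_monomial_gt0 a : 0 < N a.
Proof.
have [v [s [v0 s0 h]]] := sqnorm_monomial_ge Omega_reinhardt.
by apply: lt_le_trans (h a); rewrite mulr_gt0// exprn_gt0.
Qed.

Lemma inner_monomials a b : <[monomial a, monomial b]> = if a == b then (N b)%:C else 0.
Proof.
by have [->|ab] := eqVneq a b; [exact: L2inner_self | exact: monomial_orthogonal].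
Qed.

Lemma orthogonal_monomials f m : L2 Omega m ->
  (forall b, <[monomial b, m]> = 0) -> bergman Omega f -> <[f, m]> = 0.
Proof.
move=> mL h fB; have [S mS] := monomials_complete.
by apply: (orthogonal_complete mD mS mL) => // b _; exact: h.
Qed.

Variable alpha : nat * nat.

(** The coefficient of the projection of conj(z^alpha) z^g to the Bergman space
on z^(g - alpha). Unless alpha <= g that projection is 0, and so is the
coefficient, which makes the truncation in [subm] harmless. *)
Definition hankel_coef g : R := if leqm alpha g then N g / N (subm g alpha) else 0.

(** The image of z^g under the Hankel operator with symbol conj(z^alpha). *)
Definition hankel_monomial g (z : C2) : C :=
  - (hankel_coef g)%:C * monomial (subm g alpha) z + (monomial alpha z)^*%C * monomial g z.

(** The squared norm of [hankel_monomial g], see [sqnorm_hankel_monomial]. *)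
Definition hankel_sqnorm g : R := N (addm alpha g) - hankel_coef g * N g.

Lemma L2_conj_monomialM a f : L2 Omega f ->
  L2 Omega (fun z => (monomial a z)^*%C * f z).
Proof.
move=> fL; have /(L2_conj mD)/= := L2_monomialM Omega_reinhardt a (L2_conj mD fL).
by under eq_fun do rewrite rmorphM /= conjcK.
Qed.

Lemma L2_hankel_monomial g : L2 Omega (hankel_monomial g).
Proof. by apply: (L2_lin mD) => //; exact: L2_conj_monomialM. Qed.

(** <z^b, conj(z^alpha) z^g> = <z^(alpha + b), z^g> vanishes unless
g = alpha + b, and in that case [hankel_coef] cancels it. *)
Lemma monomial_hankel_monomial b g : <[monomial b, hankel_monomial g]> = 0.
Proof.
rewrite /hankel_monomial L2inner_linr//; last exact: L2_conj_monomialM.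
rewrite -[X in _ + X]L2inner_Ml.
rewrite monomial_mul !inner_monomials /hankel_coef.
have [le_ag|nle_ag] := boolP (leqm alpha g); last first.
  rewrite conjc_oppreal oppr0 mul0r add0r; case: eqP => // abg.
  by move: nle_ag; rewrite -abg leqm_addr.
have -> : (addm alpha b == g) = (b == subm g alpha).
  by rewrite -{1}(submK le_ag) (inj_eq (@addmI alpha)).
have [_|_] := eqVneq; last by rewrite mulr0 addr0.
rewrite conjc_oppreal mulNr -rmorphM/= divfK ?addNr//.
by rewrite gt_eqF// sqnorm_monomial_gt0.
Qed.

Lemma bergman_hankel_monomial f g : bergman Omega f -> <[f, hankel_monomial g]> = 0.
Proof.
by apply: orthogonal_monomials => [|b];
  [exact: L2_hankel_monomial | exact: monomial_hankel_monomial].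
Qed.

(** The correction term of [hankel_monomial g] is in the Bergman space, so only
conj(z^alpha) z^g contributes. *)
Lemma inner_hankel_monomial g g' :
  <[hankel_monomial g, hankel_monomial g']> =
    if g == g' then (hankel_sqnorm g)%:C else 0.
Proof.
rewrite {1}/hankel_monomial L2inner_linl//;
  [|exact: L2_conj_monomialM|exact: L2_hankel_monomial].
rewrite monomial_hankel_monomial mulr0 add0r /hankel_monomial L2inner_linr//;
  [|exact: L2_conj_monomialM|exact: L2_conj_monomialM].
rewrite !L2inner_conjMl monomial_mul.
have -> : (fun z : C2 => monomial alpha z * ((monomial alpha z)^*%C * monomial g' z)) =
    (fun z => (monomial alpha z)^*%C * monomial (addm alpha g') z).
  by apply/funext => z; rewrite monomialD mulrCA.
rewrite -L2inner_Ml monomial_mul !inner_monomials (inj_eq (@addmI alpha)).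
rewrite /hankel_sqnorm /hankel_coef.
have [<-|gg'] := eqVneq g g'.
  have [le_ag|nle_ag] := boolP (leqm alpha g).
    rewrite submK// eqxx conjc_oppreal -rmorphN -rmorphM -rmorphD.
    by congr (_%:C); ring.
  by rewrite conjc_oppreal oppr0 !mul0r add0r subr0.
rewrite addr0; have [le_ag|nle_ag] := boolP (leqm alpha g').
  by rewrite submK// (negPf gg') mulr0.
by rewrite conjc_oppreal oppr0 mul0r.
Qed.

Lemma sqnorm_hankel_monomial g : sqnorm Omega (hankel_monomial g) = hankel_sqnorm g.
Proof. by apply: (@complexI R); rewrite -L2inner_self inner_hankel_monomial eqxx. Qed.

Definition taylor_coeff (f : C2 -> C) : C := <[f, monomial alpha]> / (N alpha)%:C.

(** Moving all factors other than f to one side, the left-hand side is the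
conjugate of <f, m0> with m0 = conj(w) z^g and w = [hankel_monomial g].
Orthogonality gives <z^b, m0> = 0 for b <> alpha and <z^alpha, m0> = |w|^2, so
m0 and (|w|^2 / N alpha) z^alpha have the same inner product with every element
of the Bergman space. *)
Lemma inner_conj_hankel_monomial f g : bergman Omega f ->
  <[fun z => (f z)^*%C * monomial g z, hankel_monomial g]> =
    (taylor_coeff f)^*%C * (hankel_sqnorm g)%:C.
Proof.
move=> fB; have fL : L2 Omega f by case: fB.
pose m0 z := monomial g z * (hankel_monomial g z)^*%C.
have m0L : L2 Omega m0.
  by apply: L2_monomialM => //; apply: L2_conj => //; exact: L2_hankel_monomial.
pose k := hankel_sqnorm g / N alpha.
pose m z := - k%:C * monomial alpha z + m0 z.
have mL : L2 Omega m by apply: (L2_lin mD).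
have m0E b : <[monomial b, m0]> =
    <[fun z => hankel_monomial g z * monomial b z, monomial g]>.
  rewrite L2inner_Ml /m0; congr L2inner; apply/funext => z.
  by rewrite mulrC.
have mb b : <[monomial b, m]> = 0.
  rewrite /m L2inner_linr// m0E.
  have -> : (fun z => hankel_monomial g z * monomial b z) = (fun z =>
      - (hankel_coef g)%:C * monomial (addm (subm g alpha) b) z +
      (monomial alpha z)^*%C * monomial (addm g b) z).
    by apply/funext => z; rewrite /hankel_monomial !monomialD; ring.
  rewrite L2inner_linl//; last exact: L2_conj_monomialM.
  rewrite L2inner_conjMl monomial_mul !inner_monomials.
  have N0 : N alpha != 0 by rewrite gt_eqF// sqnorm_monomial_gt0.
  rewrite [addm g b]addmC [addm alpha g]addmC [addm b g]addmC (inj_eq (@addmI g)).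
  have [->|ba] := eqVneq b alpha.
    rewrite /k /hankel_sqnorm /hankel_coef.
    have [le_ag|nle_ag] := boolP (leqm alpha g).
      rewrite [addm (subm g alpha) alpha]addmC submK// eqxx [addm alpha g]addmC.
      rewrite conjc_oppreal; simpc; congr (_ +i* _); field.
      by rewrite N0 gt_eqF// sqnorm_monomial_gt0.
    rewrite conjc_oppreal mul0r subr0; simpc.
    by rewrite [addm alpha g]addmC; congr (_ +i* _); field.
  rewrite mulr0 add0r addr0 /hankel_coef.
  have [le_ag|nle_ag] := boolP (leqm alpha g); last by rewrite oppr0 mul0r.
  case: eqP => [E|_]; last by rewrite mulr0.
  by case/eqP: ba; apply: (@addmI (subm g alpha)); rewrite E addmC submK.
have := orthogonal_monomials mL mb fB.
rewrite /m L2inner_linr// => /eqP; rewrite addrC addr_eq0 => /eqP fm0.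
have cfL : L2 Omega (fun z => (f z)^*%C * monomial g z).
  have := L2_monomialM Omega_reinhardt g (L2_conj mD fL).
  by under eq_fun do rewrite mulrC.
rewrite (L2innerC mD (L2_hankel_monomial g) cfL) -L2inner_Ml.
have -> : (fun z => f z * hankel_monomial g z) = (fun z => hankel_monomial g z * f z).
  by apply/funext => z; rewrite mulrC.
rewrite L2inner_Ml.
have -> : (fun z => (hankel_monomial g z)^*%C * monomial g z) = m0.
  by apply/funext => z; rewrite /m0 mulrC.
rewrite fm0 conjc_oppreal mulNr opprK /taylor_coeff /k.
transitivity ((taylor_coeff f * (hankel_sqnorm g)%:C)^*)%C; last first.
  by rewrite rmorphM; congr (_ * _); exact: conjc_real.
by congr conjc; rewrite /taylor_coeff rmorphM fmorphV mulrC mulrA mulrAC.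
Qed.

End hankel_monomials.

Section hankel_bound.
Context {R : realType}.
Local Notation C := R[i].
Local Notation C2 := (R[i] * R[i])%type.
Variable phi : C -> R.
Local Notation Omega := (hartogs phi).
Hypothesis Omega_reinhardt : complete_reinhardt Omega.
Hypothesis monomials_complete : exists S : set (nat * nat),
       complete_orthogonal_system Omega S monomial.
Let mD := measurable_hartogs Omega_reinhardt.
Local Notation "<[ f , g ]>" := (L2inner Omega f g).
Local Notation N a := (sqnorm Omega (monomial a)).

(** T z^g differs from conj(f) z^g by an element of the Bergman space, to which
[hankel_monomial g] is orthogonal. *)
Lemma taylor_coeff_bound (f : C2 -> C) alpha :
  bergman Omega f -> hankel_hilbert_schmidt Omega f ->
  exists H : R, forall s : seq (nat * nat), uniq s ->
    Normc.normc (taylor_coeff phi alpha f) ^+ 2 *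
      \sum_(g <- s) hankel_sqnorm phi alpha g / N g <= H.
Proof.
move=> fB [T [THS hT]].
have [H hH] := @hilbert_schmidt_bound _ _ mD T _ monomial (hankel_monomial phi alpha) THS
   (bergman_monomial Omega_reinhardt) (L2_hankel_monomial Omega_reinhardt alpha)
   ltac:(by move=> i j ij; rewrite inner_hankel_monomial// (negPf ij)).
exists H => s us; apply: le_trans (hH s us); rewrite mulr_sumr.
apply: ler_sum => g _; rewrite sqnorm_hankel_monomial//.
have fL : L2 Omega f by case: fB.
have fgL : L2 Omega (fun z => (f z)^*%C * monomial g z).
  have := L2_monomialM Omega_reinhardt g (L2_conj mD fL).
  by under eq_fun do rewrite mulrC.
have [_ [p [_ pB _] ae]] := hT _ (bergman_monomial Omega_reinhardt g) fgL.
have [_ pL] := pB.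
have TgL : L2 Omega (T (monomial g)).
  by case: THS => -[TL _ _] _; apply: TL; exact: bergman_monomial.
have E : (fun z => (f z)^*%C * monomial g z - p z) =
    (fun z => -1 * p z + (f z)^*%C * monomial g z).
  by apply/funext => z; rewrite mulN1r addrC.
rewrite E in ae.
have wL := L2_hankel_monomial Omega_reinhardt alpha g.
rewrite (L2inner_ae mD TgL (L2_lin mD _ pL fgL) wL ae) L2inner_linl//.
rewrite bergman_hankel_monomial// mulr0 add0r inner_conj_hankel_monomial//.
rewrite [Normc.normc (_^*%C * _)]Normc.normcM normc_real.
rewrite normc_conj exprMn real_normK ?num_real//.
have [->|d0] := eqVneq (hankel_sqnorm phi alpha g) 0.
  by rewrite expr0n /= !mul0r !mulr0 mul0r.
have := sqnorm_monomial_gt0 Omega_reinhardt g => N0.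
rewrite le_eqVlt; apply/orP; left; apply/eqP; field.
by rewrite d0 gt_eqF.
Qed.
End hankel_bound.

(** * Divergence along half-lines *)

Section divergence.
Context {R : realType}.
Local Notation C := R[i].
Local Notation C2 := (R[i] * R[i])%type.
Variable phi : C -> R.
Local Notation Omega := (hartogs phi).
Hypothesis Omega_reinhardt : complete_reinhardt Omega.
Local Notation N a := (sqnorm Omega (monomial a)).
Variable alpha : nat * nat.
Hypothesis alpha0 : alpha != (0, 0)%N.

Definition line (b : nat * nat) k := (b.1 + k * alpha.1, b.2 + k * alpha.2)%N.

(** Infinitely many multi-indices not above alpha, whose half-lines in the
direction alpha are disjoint. *)
Definition base n : nat * nat := if (0 < alpha.1)%N then (0, n)%N else (n, 0)%N.

Lemma line0 b : line b 0 = b.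
Proof. by case: b => ? ?; rewrite /line !mul0n !addn0. Qed.

Lemma lineS b k : line b k.+1 = addm alpha (line b k).
Proof. by rewrite /line /addm /= !mulSn; congr (_, _); rewrite addnCA. Qed.

Lemma base_nleqm n : ~~ leqm alpha (base n).
Proof.
rewrite /leqm /base; case: ltnP => /= h; first by rewrite leqNgt h.
rewrite leqn0; move: alpha0 h; rewrite leqn0; case: alpha => a1 a2 /=.
by rewrite xpair_eqE => + /eqP a10; rewrite a10 /= => /negPf ->.
Qed.

Lemma line_inj n k n' k' : line (base n) k = line (base n') k' -> n = n' /\ k = k'.
Proof.
rewrite /line /base; case: ltnP => /= [a1 [] | a1 []].
  rewrite !add0n => /eqP; rewrite eqn_pmul2r// => /eqP -> /eqP.
  by rewrite eqn_add2r => /eqP.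
move: alpha0 a1; rewrite leqn0; case: alpha => a1 a2 /=.
rewrite xpair_eqE => + /eqP a10; rewrite a10 /= !muln0 !addn0 !add0n -lt0n => a20 -> /eqP.
by rewrite eqn_pmul2r// => /eqP.
Qed.

Definition ratio g : R := N (addm alpha g) / N g.

(** Each term is the difference of two consecutive ratios. *)
Lemma sum_line n K :
  \sum_(k <- iota 0 K.+1)
     hankel_sqnorm phi alpha (line (base n) k) / N (line (base n) k) = ratio (line (base n) K).
Proof.
have N0 a := gt_eqF (sqnorm_monomial_gt0 Omega_reinhardt a).
elim: K => [|K IH].
  by rewrite big_seq1 line0 /hankel_sqnorm /hankel_coef (negPf (base_nleqm n)) mul0r subr0.
rewrite -addn1 iotaD big_cat IH big_seq1 add0n lineS.
rewrite /hankel_sqnorm /hankel_coef leqm_addr addmK /ratio.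
by rewrite /=; field; rewrite !N0.
Qed.

(** Otherwise N decreases along the half-line at least like powers of d, half of
the rate s^|alpha| that [sqnorm_monomial_ge] allows. *)
Lemma ratio_large : exists2 d : R, 0 < d & forall b, exists k, d <= ratio (line b k).
Proof.
have [v [s [v0 s0 vs]]] := sqnorm_monomial_ge Omega_reinhardt.
have Ngt0 a := sqnorm_monomial_gt0 Omega_reinhardt a.
pose d := s ^+ (alpha.1 + alpha.2) / 2.
have d0 : 0 < d by rewrite divr_gt0// exprn_gt0.
exists d => // b; apply: contrapT => /forallNP small.
have le_N k : N (line b k) <= N b * d ^+ k.
  elim: k => [|k IH]; first by rewrite line0 expr0 mulr1.
  have /negP := small k; rewrite -ltNge /ratio ltr_pdivrMr// -lineS => /ltW h.
  by rewrite exprS mulrCA (le_trans h)// ler_pM2l.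
have ge_N k : v * s ^+ (b.1 + b.2) * (2 * d) ^+ k <= N (line b k).
  apply: le_trans (vs (line b k)); rewrite /d mulrC [2 * _]mulrC divfK// -exprM.
  rewrite mulrCA -exprD le_eqVlt; apply/orP; left; apply/eqP.
  by rewrite /line /= addnACA -mulnDr [(k * _)%N]mulnC addnC.
pose c := v * s ^+ (b.1 + b.2).
have c0 : 0 < c by rewrite mulr_gt0// exprn_gt0.
have le2 k : c * k%:R <= N b.
  have := le_trans (ge_N k) (le_N k).
  rewrite exprMn mulrA ler_pM2r ?exprn_gt0// -/c; apply: le_trans.
  by rewrite ler_pM2l// -natrX ler_nat ltnW// ltn_expl.
have := archi_boundP (divr_ge0 (ltW (Ngt0 b)) (ltW c0)).
by rewrite ltr_pdivrMr// mulrC ltNge le2.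
Qed.

Lemma taylor_coeff_eq0 (f : C2 -> C) :
  (exists S : set (nat * nat), complete_orthogonal_system Omega S monomial) ->
  bergman Omega f -> hankel_hilbert_schmidt Omega f ->
  taylor_coeff phi alpha f = 0.
Proof.
move=> monC fB fHS; have [H hH] := taylor_coeff_bound Omega_reinhardt monC alpha fB fHS.
have [d d0 /(_ (base _)) hd] := ratio_large.
(* on the half-line from base n the sum stops at an index where the ratio is at
   least d *)
pose K n := projT1 (cid (hd n)).
have Kd n : d <= ratio (line (base n) (K n)) by rewrite /K; case: cid.
pose F m := [seq line (base n) k | n <- iota 0 m, k <- iota 0 (K n).+1].
have Funiq m : uniq (F m).
  apply: allpairs_uniq_dep => [|n _|]; try exact: iota_uniq.
  by move=> [n k] [n' k'] _ _ /= /line_inj[-> ->].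
pose c2 := Normc.normc (taylor_coeff phi alpha f) ^+ 2.
have c20 : 0 <= c2 by rewrite sqr_ge0.
have bound m : c2 * d * m%:R <= H.
  apply: le_trans (hH _ (Funiq m)); rewrite -mulrA ler_wpM2l//.
  rewrite /F big_allpairs_dep/=.
  rewrite (eq_bigr (fun n => ratio (line (base n) (K n)))); last first.
    by move=> n _; exact: sum_line.
  apply: (@le_trans _ _ (\sum_(n <- iota 0 m) d)); last exact: ler_sum.
  by rewrite big_const_seq count_predT size_iota iter_addr_0 mulr_natr.
apply/eqP/negPn/negP => c0.
have cd0 : 0 < c2 * d.
  rewrite mulr_gt0// exprn_gt0// lt_def normc_ge0 andbT.
  by apply: contraNneq c0 => /Normc.eq0_normc ->.
have H0 : 0 <= H by have := bound 0; rewrite mulr0.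
have := archi_boundP (divr_ge0 H0 (ltW cd0)).
by rewrite ltr_pdivrMr// mulrC ltNge bound.
Qed.
End divergence.

(** * Conclusion *)

Theorem theorem1 (R : realType) (phi : R[i] -> R)
    (phi_radial : forall z1 : R[i], `|z1| < 1 -> phi z1 = phi `|z1|)
    (Omega_domain : domain (hartogs phi))
    (Omega_reinhardt : complete_reinhardt (hartogs phi))
    (Omega_pseudoconvex : pseudoconvex (hartogs phi))
    (monomials_complete : exists S : set (nat * nat),
       complete_orthogonal_system (hartogs phi) S monomial)
    (f : R[i] * R[i] -> R[i])
    (f_bergman : bergman (hartogs phi) f)
    (hankel_HS : hankel_hilbert_schmidt (hartogs phi) f) :
  exists c : R[i], forall z, hartogs phi z -> f z = c.
Proof.
have mD := measurable_hartogs Omega_reinhardt.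
have [oO _ _] := Omega_domain.
have monB a := bergman_monomial Omega_reinhardt a.
have monL a : L2 (hartogs phi) (monomial a) by case: (monB a).
have fL : L2 (hartogs phi) f by case: f_bergman.
have N0 a := gt_eqF (sqnorm_monomial_gt0 Omega_reinhardt a).
pose o : nat * nat := (0, 0)%N.
pose m := fun z => - taylor_coeff phi o f * monomial o z + f z.
have mB : bergman (hartogs phi) m by exact: bergman_lin.
have mL : L2 (hartogs phi) m by case: mB.
have taylor_coeffK a : L2inner (hartogs phi) f (monomial a) =
    taylor_coeff phi a f * (sqnorm (hartogs phi) (monomial a))%:C.
  by rewrite /taylor_coeff divfK// eq_complex /= eqxx andbT N0.
have m_orth a : L2inner (hartogs phi) (monomial a) m = 0.
  rewrite (L2innerC mD mL (monL a)) /m L2inner_linl// inner_monomials// taylor_coeffK.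
  have [<-|oa] := eqVneq o a; first by rewrite mulNr addNr rmorph0.
  rewrite mulr0 add0r (taylor_coeff_eq0 Omega_reinhardt) ?mul0r ?rmorph0//.
  by rewrite eq_sym.
have m0 : sqnorm (hartogs phi) m = 0.
  apply: (@complexI R); rewrite -L2inner_self.
  exact: (orthogonal_monomials Omega_reinhardt monomials_complete mL m_orth mB).
exists (taylor_coeff phi o f) => z Oz.
have := bergman_eq0 oO mD mB m0 Oz.
by rewrite /m /monomial !expr0 !mulr1 addrC => /eqP; rewrite subr_eq0 => /eqP.
Qed.
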